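(* Let $\phi(z)=bz+cz^2+\int_{(0,\infty)}(e^{-zu}-1+zu)\,m(du)$ and $\psi(z)=\beta z+\int_{(0,\infty)}(1-e^{-zu})\,\nu(du)$ be branching and immigration mechanisms with $\int_{(0,\infty)}u\,\nu(du)<\infty$, and let $(P_t)_{t\ge 0}$ be the transition semigroup of the corresponding CBI-process. Suppose that $b>0$ and that there is some constant $\theta>0$ so that $$\phi(z)>0\ \text{ for } z\ge\theta\quad\text{and}\quad\int_\theta^\infty\phi(z)^{-1}\,dz<\infty .$$ Then for any $x\ge 0$ and $t\ge r>0$ we have $$\|P_t(x,\cdot)-\eta(\cdot)\|_{\rm var}\le 2\big[x+b^{-1}\psi'(0)\big]\bar v_r\,e^{b(r-t)},$$ where $\eta$ is the probability measure on $[0,\infty)$ with Laplace transform $$\int_{[0,\infty)}e^{-\lambda y}\,\eta(dy)=\exp\bigg\{-\int_0^\infty\psi(v_s(\lambda))\,ds\bigg\}=\exp\bigg\{-\int_0^\lambda\frac{\psi(z)}{\phi(z)}\,dz\bigg\},\qquad\lambda\ge 0 .$$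
   Context: Mechanisms: $b\in\mathbb{R}$, $c\ge 0$, $m$ is a $\sigma$-finite measure on $(0,\infty)$ with $\int_{(0,\infty)}(u\wedge u^2)\,m(du)<\infty$; $\beta\ge 0$ and $\nu$ is a $\sigma$-finite measure on $(0,\infty)$ with $\int_{(0,\infty)}(1\wedge u)\,\nu(du)<\infty$. $\psi'(0)=\beta+\int_{(0,\infty)}u\,\nu(du)$. For $\lambda\ge 0$, $t\mapsto v_t(\lambda)$ is the unique nonnegative solution of $v_t(\lambda)=\lambda-\int_0^t\phi(v_s(\lambda))\,ds$. The transition semigroup of the CBI-process is given by $\int_{[0,\infty)}e^{-\lambda y}P_t(x,dy)=\exp\{-xv_t(\lambda)-\int_0^t\psi(v_s(\lambda))\,ds\}$, $\lambda\ge 0$. $\bar v_t=\lim_{\lambda\to\infty}v_t(\lambda)$ (an increasing limit), finite for $t>0$ under the stated integral condition. The total variation norm of a signed measure $\mu$ is $\sup_f|\int f\,d\mu|$ over Borel $f$ on $[0,\infty)$ with $\sup|f|\le 1$. *)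

(* Defs.v *)
From HB Require Import structures.
From mathcomp Require Import all_boot all_order all_algebra.
From mathcomp Require Import all_classical all_reals all_analysis.

Set Implicit Arguments.
Unset Strict Implicit.
Unset Printing Implicit Defensive.

Import Order.TTheory GRing.Theory Num.Theory.
Import numFieldNormedType.Exports.

Local Open Scope classical_set_scope.
Local Open Scope ring_scope.

(* Conventions.
   - A measure on (0, oo) is given by a measure on the Borel sets of R of which
     only the restriction to `]0, +oo[ is ever used.
   - The state space [0, oo) is the subset `[0, +oo[ of R: the laws on it are
     the probabilities on R giving mass 1 to `[0, +oo[, and functions indexed
     by states, times or Laplace arguments are only constrained at nonnegative
     values. *)

Section CBI.
Context {R : realType}.
Local Notation RM := (measurableTypeR R).
Local Notation leb := (@lebesgue_measure R).

Definition branching_measure (m : {measure set RM -> \bar R}) : Prop :=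
  sigma_finite (`]0%R, +oo[%classic : set R) m /\
  (\int[m]_(u in `]0%R, +oo[) (Num.min u (u ^+ 2))%:E < +oo)%E.

Definition immigration_measure (nu : {measure set RM -> \bar R}) : Prop :=
  sigma_finite (`]0%R, +oo[%classic : set R) nu /\
  (\int[nu]_(u in `]0%R, +oo[) (Num.min 1 u)%:E < +oo)%E.

(* For z >= 0 the integrands are nonnegative and integrable as soon as the
   conditions above hold, so the real-valued integrals are the usual ones. *)
Definition branching_mechanism (b c : R) (m : {measure set RM -> \bar R})
    (z : R) : R :=
  b * z + c * z ^+ 2
  + \int[m]_(u in `]0, +oo[) (expR (- (z * u)) - 1 + z * u).

Definition immigration_mechanism (beta : R) (nu : {measure set RM -> \bar R})
    (z : R) : R :=
  beta * z + \int[nu]_(u in `]0, +oo[) (1 - expR (- (z * u))).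

(* psi'(0), when nu has a finite first moment. *)
Definition immigration_mean (beta : R) (nu : {measure set RM -> \bar R}) : R :=
  beta + \int[nu]_(u in `]0, +oo[) u.

(* v t lambda is v_t(lambda). Integrability on [0, t] is what gives a meaning
   to the integral in the equation. *)
Definition cumulant_semigroup (phi : R -> R) (v : R -> R -> R) : Prop :=
  forall lambda t : R, 0 <= lambda -> 0 <= t ->
    [/\ 0 <= v t lambda,
        leb.-integrable `[0, t] (fun s => (phi (v s lambda))%:E)
      & v t lambda = lambda - \int[leb]_(s in `[0, t]) phi (v s lambda)].

(* Increasing limit, taken in the extended reals. *)
Definition cumulant_limit (v : R -> R -> R) (t : R) : \bar R :=
  lim ((v t lambda)%:E @[lambda --> +oo%R]).

Definition laplace (mu : {measure set RM -> \bar R}) (lambda : R) : \bar R :=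
  (\int[mu]_(y in `[0%R, +oo[) (expR (- (lambda * y)))%:E)%E.

Definition transition_semigroup (P : R -> R.-pker RM ~> RM) : Prop :=
  (forall t x : R, 0 <= t -> 0 <= x -> P t x (`[0%R, +oo[%classic : set R) = 1%E) /\
  (forall (s t x : R) (A : set RM), 0 <= s -> 0 <= t -> 0 <= x -> measurable A ->
     P (s + t) x A = (\int[P s x]_(y in `[0%R, +oo[) P t y A)%E).

Definition CBI_semigroup (psi : R -> R) (v : R -> R -> R)
    (P : R -> R.-pker RM ~> RM) : Prop :=
  transition_semigroup P /\
  forall t x lambda : R, 0 <= t -> 0 <= x -> 0 <= lambda ->
    laplace (P t x) lambda =
    (expR (- (x * v t lambda) - \int[leb]_(s in `[0, t]) psi (v s lambda)))%:E.

(* Total variation norm on [0, oo) of the signed measure mu1 - mu2, the two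
   measures being finite. *)
Definition var_norm_sub (mu1 mu2 : {measure set RM -> \bar R}) : \bar R :=
  ereal_sup [set `| \int[mu1]_(y in `[0%R, +oo[) (f y)%:E
                    - \int[mu2]_(y in `[0%R, +oo[) (f y)%:E |%E
            | f in [set f : R -> R |
                measurable_fun (`[0%R, +oo[%classic : set R) f /\
                forall y : R, 0 <= y -> `|f y| <= 1]].

End CBI.

(* Main.v *)
(* Writing Q_t e^{-l .} = e^{-v_t(l) .} for the semigroup without immigration, one
   only needs Q_t on finite sums of exponentials, where no process has to be
   constructed. There Q_t solves the backward equation of the branching generator,
   so the maximum principle makes it positive. Comparing a sum H with values in
   [0, 1] near 0 with 1 - e^{-l z} for large l then gives
   |Q_t H(x + h) - Q_t H(x)| <= h vbar_t, which passes to P_t by integrating the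
   shifts of H against P_t(0, .), and to Borel sets by density of exponential
   sums. With the Chapman-Kolmogorov equation and the bound b^-1 psi'(0) on the
   mean of P_s(0, .) this yields
   |P_t(x, A) - P_{s+t}(0, A)| <= (x + b^-1 psi'(0)) vbar_t uniformly in A and s.
   As vbar_t <= vbar_r e^{b(r-t)}, and vbar_r is finite by Grey's condition, the
   laws P_t(0, .) converge uniformly on Borel sets; eta is their limit. *)

Require Import Defs.
From HB Require Import structures.
From mathcomp Require Import all_boot all_order all_algebra.
From mathcomp Require Import all_classical all_reals all_analysis.
From mathcomp Require Import measurable_realfun ring lra.

Set Implicit Arguments.
Unset Strict Implicit.
Unset Printing Implicit Defensive.

Import Order.TTheory GRing.Theory Num.Theory.
Import numFieldNormedType.Exports.

Local Open Scope classical_set_scope.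
Local Open Scope ring_scope.

(** * Branching and immigration mechanisms *)

(** Total variation tests functions without any regularity, whereas [CBI_semigroup] gives only
    Laplace transforms. What bridges the gap is that the bound [h * V] for exponential sums with
    values in [0, 1] depends neither on their coefficients nor on their rates, so it survives L^1
    limits. This uniformity in the rates is why the supremum vbar_t of v_t, and with it Grey's
    condition, enters. Positivity of Q_t is exploited through the choice of the sum to which it is
    applied: 1 - H gives contraction, e^{-l z} - e^{-l' z} gives monotonicity of v_t in l, and a
    barrier gives the Lipschitz bound. Origin of the constants: the mean of |x - Y| for Y of law
    P_s(0, .) is at most x + E Y, and E Y <= b^-1 psi'(0) because psi z <= psi'(0) z and b z <= phi
    z. The factor e^{b(r-t)} reflects that phi has slope at least b. The factor 2 comes from writing
    f with |f| <= 1 as 2 g - 1 with g in [0, 1]; passing from sets to such g costs nothing. *)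

Section expR_bounds.
Context {R : realType}.
Implicit Types w x y z u : R.

Lemma expRN_ge1B w : 1 - w <= expR (- w).
Proof. exact: expR_ge1Dx. Qed.

Lemma oneB_expRN_le w : 1 - expR (- w) <= w.
Proof. by rewrite lerBlDr addrC -lerBlDr; exact: expRN_ge1B. Qed.

Lemma expRN_itv w : 0 <= w -> 0 <= expR (- w) <= 1.
Proof. by move=> w0; rewrite expR_ge0 expR_le1 oppr_le0. Qed.

Lemma oneB_expRN_ge w : w * expR (- w) <= 1 - expR (- w).
Proof.
have := expR_ge1Dx w; have := expRxMexpNx_1 w; have := expR_ge0 (- w).
by move=> *; nra.
Qed.

Lemma oneB_expRN_itv u z y : 0 <= u -> 0 <= y -> y <= z ->
  0 <= (1 - expR (- (z * u))) - (1 - expR (- (y * u))) <= (z - y) * u.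
Proof.
move=> u0 y0 yz.
have -> : - (z * u) = - (y * u) + - ((z - y) * u) by ring.
rewrite expRD.
have d0 : 0 <= (z - y) * u by rewrite mulr_ge0 // subr_ge0.
have /andP[a0 a1] := expRN_itv (mulr_ge0 y0 u0).
have /andP[b0 b1] := expRN_itv d0.
have := expRN_ge1B ((z - y) * u).
by move=> ?; apply/andP; split; nra.
Qed.

(** The derivative in z of e^{-zu} - 1 + zu is u (1 - e^{-zu}), nonnegative, increasing and at most
    u min(1, zu) <= (1 + z) min(u, u^2). The last form is the one that the moment condition on [m]
    can integrate. *)
Lemma expRN_taylor1_itv u z y : 0 <= u -> 0 <= y -> y <= z ->
  0 <= (expR (- (z * u)) - 1 + z * u) - (expR (- (y * u)) - 1 + y * u)
    <= (z - y) * (1 + z) * Num.min u (u ^+ 2).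
Proof.
move=> u0 y0 yz; have /andP[_ ub] := oneB_expRN_itv u0 y0 yz.
have zy0 : 0 <= z - y by rewrite subr_ge0.
have d0 : 0 <= (z - y) * u by rewrite mulr_ge0.
have ze := expRN_ge1B (z * u).
have /andP[e0 e1] := expRN_itv (mulr_ge0 (le_trans y0 yz) u0).
have e2 := oneB_expRN_ge ((z - y) * u).
have lb : (z - y) * u * expR (- (z * u)) <= expR (- (y * u)) - expR (- (z * u)).
  have -> : - (z * u) = - (y * u) + - ((z - y) * u) by ring.
  by rewrite expRD; have := expR_ge0 (- (y * u)); nra.
apply/andP; split; first by lra.
apply: (@le_trans _ _ ((z - y) * u * (1 - expR (- (z * u))))); first by lra.
rewrite -!mulrA ler_wpM2l // minEle; case: ifP => [uu2|_].
  by rewrite mulrC ler_wpM2r //; lra.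
apply: (@le_trans _ _ (u * (z * u))); first by rewrite ler_wpM2l //; lra.
by rewrite expr2; nra.
Qed.

End expR_bounds.

Section mechanisms.
Context {R : realType}.
Local Notation RM := (measurableTypeR R).
Implicit Types (m nu : {measure set RM -> \bar R}) (b c beta y z Z : R).

Lemma measurable_affine_expR (D : set R) (a b c z : R) :
  measurable_fun D (fun u : R => a * expR (- (z * u)) + b * u + c).
Proof.
apply: measurable_funD; [apply: measurable_funD|by []]; apply: measurable_funM => //.
apply: measurableT_comp; first exact: measurable_expR.
by apply: measurableT_comp => //; exact: measurable_funM.
Qed.

Definition branching_moment m : R :=
  \int[m]_(u in `]0, +oo[) Num.min u (u ^+ 2).

Lemma branching_measure_integrable m : branching_measure m ->
  m.-integrable `]0, +oo[ (EFin \o (fun u : R => Num.min u (u ^+ 2))).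
Proof.
move=> [_ mlty]; apply/integrableP; split.
  by apply/measurable_EFinP; apply: measurable_minr => //; exact: measurable_funX.
under eq_integral.
  move=> u; rewrite inE /= in_itv /= andbT => u0.
  rewrite ger0_norm; last by rewrite le_min ltW //= sqr_ge0.
  by over.
by [].
Qed.

Lemma branching_moment_ge0 m : 0 <= branching_moment m.
Proof.
apply: Rintegral_ge0 => u; rewrite /= in_itv /= andbT => u0.
by rewrite le_min ltW //= sqr_ge0.
Qed.

Lemma branching_integrable m z : branching_measure m -> 0 <= z ->
  m.-integrable `]0, +oo[ (EFin \o (fun u : R => expR (- (z * u)) - 1 + z * u)).
Proof.
move=> bm z0.
apply: (le_integrable _ _ _ (integrableZl _ (z * (1 + z)) (branching_measure_integrable bm))) => //.
- apply/measurable_EFinP.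
  have := @measurable_affine_expR `]0, +oo[ 1 z (-1) z.
  by apply: eq_measurable_fun => u _; ring.
- move=> u; rewrite /= in_itv /= andbT => u0.
  have := expRN_taylor1_itv (ltW u0) (lexx 0) z0.
  rewrite !mul0r oppr0 expR0 addr0 !subrr !subr0 ?oppr0 ?addr0 => /andP[h1 h2].
  have min0 : 0 <= Num.min u (u ^+ 2) by rewrite le_min ltW //= sqr_ge0.
  by rewrite lee_fin !ger0_norm // mulr_ge0 // mulr_ge0 // addr_ge0.
Qed.

(** The lower bound is convexity with phi'(0) = b: the quadratic and jump parts are nondecreasing on
    [0, oo). The upper bound integrates the estimate on the integrand. *)
Lemma branching_mechanism_itv b c m y z : branching_measure m -> 0 <= c ->
  0 <= y -> y <= z ->
  b * (z - y) <= branching_mechanism b c m z - branching_mechanism b c m y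
    <= (b + c * (2 * z) + (1 + z) * branching_moment m) * (z - y).
Proof.
move=> bm c0 y0 yz; have z0 := le_trans y0 yz.
set J := fun z : R => \int[m]_(u in `]0, +oo[) (expR (- (z * u)) - 1 + z * u).
have JE : J z - J y = \int[m]_(u in `]0, +oo[)
   ((expR (- (z * u)) - 1 + z * u) - (expR (- (y * u)) - 1 + y * u)).
  by rewrite RintegralB //; exact: branching_integrable.
have /andP[J0 J1] : 0 <= J z - J y <= (z - y) * (1 + z) * branching_moment m.
  rewrite JE; apply/andP; split.
    apply: Rintegral_ge0 => u; rewrite /= in_itv /= andbT => /ltW u0.
    by have /andP[] := expRN_taylor1_itv u0 y0 yz.
  rewrite -RintegralZl //; last exact: branching_measure_integrable.
  apply: le_Rintegral => //.
  - have := integrableB _ (branching_integrable bm z0) (branching_integrable bm y0).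
    by apply => //.
  - by have := integrableZl _ ((z - y) * (1 + z)) (branching_measure_integrable bm); apply.
  - move=> u; rewrite /= in_itv /= andbT => /ltW u0.
    by have /andP[] := expRN_taylor1_itv u0 y0 yz.
rewrite /branching_mechanism -/(J z) -/(J y).
have zy : 0 <= z - y by rewrite subr_ge0.
have : c * (z ^+ 2 - y ^+ 2) <= c * (2 * z) * (z - y).
  by rewrite -mulrA ler_wpM2l //; nra.
have : 0 <= c * (z ^+ 2 - y ^+ 2).
  by rewrite mulr_ge0 //; nra.
move: (J z) (J y) (branching_moment m) J0 J1 {JE} => Jz Jy I J0 J1.
by move=> *; apply/andP; split; lra.
Qed.

Definition branching_lip b c m Z := b + c * (2 * Z) + (1 + Z) * branching_moment m.

Lemma branching_mechanism_lb b c m y z : branching_measure m -> 0 <= c ->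
  0 <= y -> y <= z ->
  b * (z - y) <= branching_mechanism b c m z - branching_mechanism b c m y.
Proof. by move=> bm c0 y0 yz; have /andP[] := branching_mechanism_itv b bm c0 y0 yz. Qed.

Lemma branching_mechanism_ub b c m y z Z : branching_measure m -> 0 <= c ->
  0 <= y -> y <= z -> z <= Z ->
  branching_mechanism b c m z - branching_mechanism b c m y <= branching_lip b c m Z * (z - y).
Proof.
move=> bm c0 y0 yz zZ.
have /andP[_ /le_trans] := branching_mechanism_itv b bm c0 y0 yz; apply.
rewrite ler_wpM2r ?subr_ge0 // lerD ?lerD2l //.
  by rewrite ler_wpM2l // ler_wpM2l.
by rewrite ler_wpM2r ?branching_moment_ge0 // lerD2l.
Qed.

Lemma branching_mechanism0 b c m : branching_mechanism b c m 0 = 0.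
Proof.
rewrite /branching_mechanism mulr0 expr0n /= mulr0 !add0r.
under eq_Rintegral do rewrite !mul0r oppr0 expR0 subrr addr0.
by rewrite /Rintegral integral0.
Qed.

Lemma immigration_mean_integrable nu :
  (\int[nu]_(u in `]0%R, +oo[) u%:E < +oo)%E ->
  nu.-integrable `]0%R, +oo[ (EFin \o (fun u : R => u)).
Proof.
move=> nulty; apply/integrableP; split; first by apply/measurable_EFinP.
under eq_integral.
  move=> u; rewrite inE /= in_itv /= andbT => u0.
  by rewrite gtr0_norm //; over.
by [].
Qed.

Lemma immigration_integrable nu z :
  (\int[nu]_(u in `]0%R, +oo[) u%:E < +oo)%E -> 0 <= z ->
  nu.-integrable `]0, +oo[ (EFin \o (fun u : R => 1 - expR (- (z * u)))).
Proof.
move=> /immigration_mean_integrable nui z0.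
apply: (le_integrable _ _ _ (integrableZl _ z nui)) => //.
- apply/measurable_EFinP.
  have := @measurable_affine_expR `]0, +oo[ (-1) 0 1 z.
  by apply: eq_measurable_fun => u _; ring.
- move=> u; rewrite /= in_itv /= andbT => u0.
  have := oneB_expRN_itv (ltW u0) (lexx 0) z0.
  rewrite !mul0r oppr0 expR0 !subrr !subr0 ?oppr0 ?addr0 => /andP[h1 h2].
  by rewrite lee_fin !ger0_norm // mulr_ge0 // ltW.
Qed.

Lemma immigration_mechanism_itv beta nu y z : 0 <= beta ->
  (\int[nu]_(u in `]0%R, +oo[) u%:E < +oo)%E -> 0 <= y -> y <= z ->
  0 <= immigration_mechanism beta nu z - immigration_mechanism beta nu y
    <= immigration_mean beta nu * (z - y).
Proof.
move=> b0 nulty y0 yz; have z0 := le_trans y0 yz.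
set J := fun z : R => \int[nu]_(u in `]0, +oo[) (1 - expR (- (z * u))).
have JE : J z - J y = \int[nu]_(u in `]0, +oo[)
   ((1 - expR (- (z * u))) - (1 - expR (- (y * u)))).
  by rewrite RintegralB //; exact: immigration_integrable.
have /andP[J0 J1] : 0 <= J z - J y <= (z - y) * \int[nu]_(u in `]0, +oo[) u.
  rewrite JE; apply/andP; split.
    apply: Rintegral_ge0 => u; rewrite /= in_itv /= andbT => /ltW u0.
    by have /andP[] := oneB_expRN_itv u0 y0 yz.
  have nui := immigration_mean_integrable nulty.
  rewrite -RintegralZl //.
  apply: le_Rintegral => //.
  - have := integrableB _ (immigration_integrable nulty z0) (immigration_integrable nulty y0).
    by apply => //.
  - by have := integrableZl _ (z - y) nui; apply.
  - move=> u; rewrite /= in_itv /= andbT => /ltW u0.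
    by have /andP[] := oneB_expRN_itv u0 y0 yz.
rewrite /immigration_mechanism /immigration_mean -/(J z) -/(J y).
have : 0 <= beta * (z - y) by rewrite mulr_ge0 // subr_ge0.
move: (J z) (J y) (\int[nu]_(u in _) u) J0 J1 {JE} => Jz Jy I J0 J1.
by move=> ?; apply/andP; split; lra.
Qed.

Lemma immigration_mechanism0 beta nu : immigration_mechanism beta nu 0 = 0.
Proof.
rewrite /immigration_mechanism mulr0 add0r.
under eq_Rintegral do rewrite !mul0r oppr0 expR0 subrr.
by rewrite /Rintegral integral0.
Qed.

End mechanisms.

(** * The cumulant semigroup *)

Section real_functions.
Context {R : realType}.
Implicit Types (f g : R -> R) (a b k x y : R).

Lemma lipschitz_continuous f k :
  (forall x y, `|f x - f y| <= k * `|x - y|) -> continuous f.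
Proof.
move=> fk x; apply/cvgrPdist_le => /= e e0.
have k0 : 0 < `|k| + 1 by rewrite ltr_wpDl.
near=> y; apply: (le_trans (fk x y)).
have : `|x - y| <= e / (`|k| + 1).
  by near: y; apply: cvgr_dist_le; [exact: cvg_id|rewrite divr_gt0].
rewrite ler_pdivlMr // => h; apply: le_trans h.
by rewrite mulrC ler_wpM2l // (le_trans (ler_norm k)) // lerDl.
Unshelve. all: by end_near. Qed.

(** Mechanisms and flows are controlled only at nonnegative arguments; composing with [Num.max x 0]
    makes them continuous on the whole line and keeps subspace topologies out of the way. *)
Lemma lipschitz_clamp_continuous f k :
  (forall x y, 0 <= x -> x <= y -> `|f x - f y| <= k * (y - x)) ->
  continuous (fun x => f (Num.max x 0)).
Proof.
move=> fk; apply: (@lipschitz_continuous _ `|k|) => x y.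
wlog xy : x y / x <= y.
  move=> W; have [/W //|/ltW/W] := leP x y.
  by rewrite distrC (distrC x y).
have x0 : 0 <= Num.max x 0 by rewrite le_max lexx orbT.
have xy0 : Num.max x 0 <= Num.max y 0 by rewrite ge_max !le_max lexx xy orbT.
apply: (le_trans (fk _ _ x0 xy0)).
apply: (@le_trans _ _ (`|k| * (Num.max y 0 - Num.max x 0))).
  by rewrite ler_wpM2r ?subr_ge0 // ler_norm.
rewrite ler_wpM2l // distrC ger0_norm ?subr_ge0 //.
by rewrite !maxEle; do 2 case: ifP; lra.
Qed.

Lemma is_derive_expRM k x :
  is_derive x 1 (fun y => expR (k * y)) (k * expR (k * x)).
Proof.
have kx : is_derive x 1 (fun y => k * y) k.
  by have := is_deriveZ k (is_derive_id x 1); rewrite [_ *: 1]mulr1.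
by rewrite mulrC; exact: is_derive1_comp.
Qed.

Lemma is_derive_continuous f df x : is_derive x 1 f df -> {for x, continuous f}.
Proof.
by move=> [fx _]; apply: differentiable_continuous; exact/derivable1_diffP.
Qed.

Lemma is_derive_le0_nincr f df a b :
  (forall x, a <= x <= b -> is_derive x 1 f (df x)) ->
  (forall x, a <= x <= b -> df x <= 0) -> a <= b -> f b <= f a.
Proof.
move=> fd df0 ab.
apply: (@ler0_derive1_nincr R f a b) => //.
- move=> x; rewrite in_itv /= => /andP[/ltW ax /ltW xb].
  by have [] := fd x (introT andP (conj ax xb)).
- move=> x; rewrite in_itv /= => /andP[/ltW ax /ltW xb].
  have axb : a <= x <= b by rewrite ax.
  by have := fd x axb => fdx; rewrite derive1E derive_val; exact: df0.
- apply: continuous_in_subspaceT => x; rewrite inE /= in_itv /= => axb.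
  exact: is_derive_continuous (fd x axb).
Qed.

(** Only the left side is inspected because the minimum over a time interval [0, t] may sit at its
    right end t. *)
Lemma is_derive_left_min_le0 f l x : is_derive x 1 f l ->
  (\forall y \near x^'-, f x <= f y) -> l <= 0.
Proof.
move=> [fx <-] xmin.
have : h^-1 *: (f (h + x) - f x) @[h --> 0^'-] --> 'D_1 f x.
  apply: cvg_dnbhs_at_left.
  have := fx; rewrite /derivable => /cvg_ex[/= L fL].
  have -> : 'D_1 f x = L by apply: cvg_lim fL.
  apply: cvg_trans fL; apply: near_eq_cvg; near=> h.
  by rewrite /= /GRing.scale /= mulr1.
move/cvgr_to_le; apply; near=> h.
have h0 : h < 0 by near: h; exact: nbhs_left_lt.
rewrite /GRing.scale /= mulrC ler_ndivrMr // mul0r subr_ge0 addrC.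
near: h; rewrite -[X in X^'-]oppr0 at_leftN /=.
by apply: filterS ((nbhs_left0P _ _).1 xmin) => h; exact.
Unshelve. all: by end_near. Qed.

End real_functions.

Section cumulant.
Context {R : realType}.
Local Notation leb := (@lebesgue_measure R).
Context (phi phi_lip : R -> R) (v : R -> R -> R) (b : R).
Context (b_gt0 : 0 < b) (phi0 : phi 0 = 0).
Context (phi_lb : forall y z : R, 0 <= y -> y <= z -> b * (z - y) <= phi z - phi y).
Context (phi_ub : forall y z Z : R, 0 <= y -> y <= z -> z <= Z ->
  phi z - phi y <= phi_lip Z * (z - y)).
Context (cv : cumulant_semigroup phi v).
Implicit Types k s t lam : R.

Lemma mechanism_ge z : 0 <= z -> b * z <= phi z.
Proof. by move=> z0; have := phi_lb (lexx 0) z0; rewrite phi0 !subr0. Qed.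

Lemma mechanism_ge0 z : 0 <= z -> 0 <= phi z.
Proof.
by move=> z0; apply: le_trans (mechanism_ge z0); rewrite mulr_ge0 // ltW.
Qed.

Lemma mechanism_le y z : 0 <= y -> y <= z -> phi y <= phi z.
Proof.
move=> y0 yz; rewrite -subr_ge0; apply: le_trans (phi_lb y0 yz).
by rewrite mulr_ge0 ?subr_ge0 // ltW.
Qed.

Lemma cumulant_ge0 t lam : 0 <= lam -> 0 <= t -> 0 <= v t lam.
Proof. by move=> l0 t0; have [] := cv l0 t0. Qed.

Lemma cumulant0 lam : 0 <= lam -> v 0 lam = lam.
Proof.
move=> l0; have [_ _ ->] := cv l0 (lexx 0).
by rewrite set_itv1 Rintegral_set1 subr0.
Qed.

Lemma cumulant_le_init t lam : 0 <= lam -> 0 <= t -> v t lam <= lam.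
Proof.
move=> l0 t0; have [_ _ ->] := cv l0 t0.
rewrite gerBl; apply: Rintegral_ge0 => s; rewrite /= in_itv /= => /andP[s0 _].
exact: mechanism_ge0 (cumulant_ge0 l0 s0).
Qed.

(** The increment is the integral of phi(v_u) over ]s, t], and v_u <= lam. Continuity of the path in
    time, on which differentiability rests, comes from here. *)
Lemma cumulant_sub_itv s t lam : 0 <= lam -> 0 <= s -> s <= t ->
  0 <= v s lam - v t lam <= phi lam * (t - s).
Proof.
move=> l0 s0 st; have t0 := le_trans s0 st.
have [_ _ vs] := cv l0 s0; have [_ ti vt] := cv l0 t0.
have -> : v s lam - v t lam = \int[leb]_(u in `]s, t]) phi (v u lam).
  rewrite -(@Rintegral_itvB _ _ (BLeft 0) (BRight t) s) ?bnd_simp //.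
  by rewrite {1}vs {1}vt; lra.
apply/andP; split.
  apply: Rintegral_ge0 => u; rewrite /= in_itv /= => /andP[su _].
  by apply/mechanism_ge0/cumulant_ge0 => //; rewrite (le_trans s0) // ltW.
have st_measure : (leb (`]s, t]%classic : set R) = (t - s)%:E)%E.
  rewrite lebesgue_measure_itv /= lte_fin; case: ltP => // ts.
  by have -> : t = s by [apply/le_anti/andP]; rewrite subrr.
have -> : phi lam * (t - s) = \int[leb]_(u in `]s, t]) phi lam.
  by rewrite Rintegral_cst // -[t - s]/(fine (t - s)%:E) -st_measure.
apply: le_Rintegral => //.
- by apply: integrableS ti => //; apply: subset_itvr; rewrite bnd_simp.
- have : leb.-integrable `[s, t] (EFin \o cst (phi lam)).
    apply: continuous_compact_integrable; first exact: segment_compact.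
    by apply: continuous_subspaceT => x; exact: cst_continuous.
  by apply: integrableS => //; exact: subset_itv_oc_cc.
- move=> u; rewrite /= in_itv /= => /andP[su _].
  have u0 : 0 <= u by rewrite (le_trans s0) // ltW.
  by apply: mechanism_le; [exact: cumulant_ge0|exact: cumulant_le_init].
Qed.

Let rate lam s := phi (v (Num.max s 0) lam).

Lemma cumulant_clamp_continuous lam : 0 <= lam ->
  continuous (fun t => v (Num.max t 0) lam).
Proof.
move=> l0; apply: (@lipschitz_clamp_continuous _ (v^~ lam) (phi lam)) => s t s0 st.
by have /andP[h1 h2] := cumulant_sub_itv l0 s0 st; rewrite ger0_norm.
Qed.

Lemma mechanism_clamp_continuous : continuous (fun z : R => phi (Num.max z 0)).
Proof.
move=> x.
(* phi is only locally Lipschitz; cutting at [x + 1] makes it globally Lipschitz, and the cut is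
   invisible near [x]. *)
have : {for x, continuous (fun z => phi (Num.max (Num.min z (x + 1)) 0))}.
  apply: (@lipschitz_continuous _ _ `|phi_lip (Num.max (x + 1) 0)|) => {}y z.
  wlog yz : y z / y <= z.
    move=> W; have [/W //|/ltW/W] := leP y z.
    by rewrite distrC (distrC y z).
  set p := Num.max (Num.min y _) 0; set q := Num.max (Num.min z _) 0.
  have p0 : 0 <= p by rewrite le_max lexx orbT.
  have pq : p <= q.
    by rewrite /p /q !minEle !maxEle; do ! case: ifP => //; lra.
  have qx : q <= Num.max (x + 1) 0.
    by rewrite /q !minEle !maxEle; do ! case: ifP => //; lra.
  have qp : q - p <= `|y - z|.
    rewrite distrC ger0_norm ?subr_ge0 // /p /q.
    by rewrite !minEle !maxEle; do ! case: ifP => //; lra.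
  rewrite distrC ger0_norm ?subr_ge0; last exact: mechanism_le.
  apply: (le_trans (phi_ub p0 pq qx)).
  apply: (@le_trans _ _ (`|phi_lip (Num.max (x + 1) 0)| * (q - p))).
    by rewrite ler_wpM2r ?subr_ge0 // ler_norm.
  by rewrite ler_wpM2l.
have x1 : x <= x + 1 by rewrite lerDl.
rewrite /prop_for /continuous_at /= (min_idPl x1); apply: cvg_trans.
apply: near_eq_cvg; near=> z; rewrite (min_idPl _) // ltW //.
by near: z; apply: lt_nbhsl; rewrite ltrDl.
Unshelve. all: by end_near. Qed.

Lemma cumulant_rate_continuous lam : 0 <= lam -> continuous (rate lam).
Proof.
move=> l0.
have -> : rate lam = (fun z => phi (Num.max z 0)) \o (fun t => v (Num.max t 0) lam).
  apply/funext => t; rewrite /rate /=.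
    by congr phi; apply/esym/max_idPl/cumulant_ge0; rewrite // le_max lexx orbT.
move=> t; apply: continuous_comp; first exact: cumulant_clamp_continuous.
exact: mechanism_clamp_continuous.
Qed.

(* Extending the flow to small negative times makes it differentiable at time
   0, so that no one-sided derivative is ever needed. *)
Lemma cumulant_extension lam : 0 <= lam -> exists W : R -> R,
  (forall t, 0 <= t -> W t = v t lam) /\
  (forall t, -1 < t -> is_derive t 1 W (- phi (v (Num.max t 0) lam))).
Proof.
move=> l0; have rc := cumulant_rate_continuous l0.
have ri x y : leb.-integrable `[x, y] (EFin \o rate lam).
  apply: continuous_compact_integrable; first exact: segment_compact.
  exact: continuous_subspaceT.
pose I t := \int[leb]_(s in `[-1, t]) rate lam s.
exists (fun t => lam + I 0 - I t); split.
  move=> t t0; have [_ _ ->] := cv l0 t0.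
  have -> : \int[leb]_(s in `[0, t]) phi (v s lam) = \int[leb]_(s in `[0, t]) rate lam s.
    apply: eq_Rintegral => s; rewrite inE /= in_itv /= => /andP[s0 _].
    by rewrite /rate; congr (phi (v _ _)); apply/esym/max_idPl.
  suff : I t - I 0 = \int[leb]_(s in `[0, t]) rate lam s by move=> <-; ring.
  rewrite /I (@Rintegral_itvB _ _ (BLeft (-1)) (BRight t) 0) ?bnd_simp //.
  rewrite Rintegral_itv_obnd_cbnd //.
  by apply: integrableS (ri 0 t) => //; exact: subset_itv_oc_cc.
move=> t t1.
have [] := @continuous_FTC1_closed R (rate lam) (-1) t (t + 1) _ (ri _ _) t1 (rc t).
  by lra.
rewrite derive1E => Id Iv.
have Idt : is_derive t 1 I (rate lam t) by split.
rewrite -[- _]add0r; apply: is_deriveB.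
Qed.

Lemma is_derive_cumulant t lam : 0 <= lam -> 0 < t ->
  is_derive t 1 (v^~ lam) (- phi (v t lam)).
Proof.
move=> l0 t0; have [W [Wv dW]] := cumulant_extension l0.
have dWt : is_derive t 1 W (- phi (v t lam)).
  by rewrite -{2}(max_idPl (ltW t0)); apply: dW; lra.
apply: near_eq_is_derive dWt.
by near=> s; rewrite Wv // ltW //; near: s; exact: lt_nbhsr.
Unshelve. all: by end_near. Qed.

(** Gronwall: v_u e^{ku} has derivative (k v_u - phi(v_u)) e^{ku} <= 0, since v_u stays in
    [0, lam]. *)
Lemma cumulant_exp_nincr k s t lam : 0 <= lam -> 0 <= s -> s <= t ->
  (forall z : R, 0 <= z -> z <= lam -> k * z <= phi z) ->
  v t lam <= v s lam * expR (- (k * (t - s))).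
Proof.
move=> l0 s0 st kphi; have [W [Wv dW]] := cumulant_extension l0.
have : W t * expR (k * t) <= W s * expR (k * s).
  apply: (@is_derive_le0_nincr R (fun u => W u * expR (k * u))
    (fun u => (k * W u - phi (v u lam)) * expR (k * u)) s t) => // u /andP[su ut].
    have u0 : 0 <= u by exact: le_trans su.
    have u1 : -1 < u by lra.
    apply: (is_derive_eq (is_deriveM (dW u u1) (is_derive_expRM k u))).
    rewrite (max_idPl u0) /GRing.scale /=; ring.
  have u0 : 0 <= u by exact: le_trans su.
  rewrite Wv // mulr_le0_ge0 ?expR_ge0 // subr_le0 kphi //.
    exact: cumulant_ge0.
  exact: cumulant_le_init.
rewrite !Wv // ?(le_trans s0) // -ler_pdivlMr ?expR_gt0 // -expRN -mulrA -expRD.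
by have -> : k * s + - (k * t) = - (k * (t - s)) by ring.
Qed.

Lemma cumulant_exp_ndecr k t lam : 0 <= lam -> 0 <= t ->
  (forall z : R, 0 <= z -> z <= lam -> phi z <= k * z) ->
  lam * expR (- (k * t)) <= v t lam.
Proof.
move=> l0 t0 kphi; have [W [Wv dW]] := cumulant_extension l0.
have : - (W t * expR (k * t)) <= - (W 0 * expR (k * 0)).
  apply: (@is_derive_le0_nincr R (fun u => - (W u * expR (k * u)))
    (fun u => (phi (v u lam) - k * W u) * expR (k * u)) 0 t) => // u /andP[u0 ut].
    have u1 : -1 < u by lra.
    apply: (is_derive_eq (is_deriveN (is_deriveM (dW u u1) (is_derive_expRM k u)))).
    rewrite (max_idPl u0) /GRing.scale /=; ring.
  rewrite Wv // mulr_le0_ge0 ?expR_ge0 // subr_le0 kphi //.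
    exact: cumulant_ge0.
  exact: cumulant_le_init.
by rewrite lerN2 !Wv // mulr0 expR0 mulr1 cumulant0 // expRN ler_pdivrMr // expR_gt0.
Qed.

Lemma cumulant_decay s t lam : 0 <= lam -> 0 <= s -> s <= t ->
  v t lam <= v s lam * expR (- (b * (t - s))).
Proof. by move=> l0 s0 st; apply: cumulant_exp_nincr => // z z0 _; exact: mechanism_ge. Qed.

(** phi vanishes at 0 and is Lipschitz on [0, lam], so the flow decreases at most exponentially and
    cannot reach 0. This keeps f / phi away from its singularity in the time change. *)
Lemma cumulant_gt0 t lam : 0 < lam -> 0 <= t -> 0 < v t lam.
Proof.
move=> l0 t0; apply: (@lt_le_trans _ _ (lam * expR (- (phi_lip lam * t)))).
  by rewrite mulr_gt0 ?expR_gt0.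
apply: cumulant_exp_ndecr => // [|z z0 zl]; first exact: ltW.
by have := phi_ub (lexx 0) z0 zl; rewrite phi0 !subr0.
Qed.

Lemma cumulant_decr s t lam : 0 < lam -> 0 <= s -> s < t -> v t lam < v s lam.
Proof.
move=> l0 s0 st; apply: (le_lt_trans (cumulant_decay (ltW l0) s0 (ltW st))).
rewrite gtr_pMr ?cumulant_gt0 // expR_lt1 oppr_lt0 mulr_gt0 // subr_gt0 //.
Qed.

Lemma cumulant_substitution (G : R -> R) t lam : 0 < lam -> 0 <= t ->
  {within `[v t lam, lam], continuous G} ->
  (\int[leb]_(z in `[v t lam, lam]) (G z)%:E =
   \int[leb]_(s in `[0%R, t]) (G (v s lam) * phi (v s lam))%:E)%E.
Proof.
move=> l0 t0 cG; have [W [Wv dW]] := cumulant_extension (ltW l0).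
have W0 : W 0 = lam by rewrite Wv // cumulant0 // ltW.
have rc := cumulant_rate_continuous (ltW l0).
have cW (x : R) : -1 < x -> {for x, continuous W}.
  by move=> x1; exact: is_derive_continuous (dW x x1).
have W'E (x : R) : -1 < x -> (W^`())%classic x = - rate lam x.
  by move=> x1; rewrite derive1E; have := dW x x1 => ?; rewrite derive_val.
have W'c (x : R) : -1 < x -> (W^`())%classic y @[y --> x] --> (W^`())%classic x.
  move=> x1; rewrite W'E //; have /cvgN := rc x; apply: cvg_trans.
  apply: near_eq_cvg; near=> y.
  by rewrite W'E //; near: y; exact: lt_nbhsr.
have := @integration_by_substitution_decreasing R W G 0 t t0.
rewrite W0 (Wv t t0) => -> //.
- apply: eq_integral => s; rewrite inE /= in_itv /= => /andP[s0 _].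
  have s1 : -1 < s by lra.
  by rewrite !fctE /= Wv // W'E // /rate (max_idPl s0) opprK.
- move=> x y; rewrite !in_itv /= => /andP[x0 _] /andP[y0 _] yx.
  by rewrite !Wv //; exact: cumulant_decr.
- by move=> x; rewrite in_itv /= => /andP[x0 _]; apply: W'c; lra.
- by apply: cvgP; apply: cvg_at_right_filter; apply: W'c; lra.
- by apply: cvgP; apply: cvg_at_left_filter; apply: W'c; lra.
- split.
  + move=> x; rewrite in_itv /= => /andP[x0 _].
    by have [] : is_derive x 1 W (- phi (v (Num.max x 0) lam)) by apply: dW; lra.
  + by apply: cvg_at_right_filter; apply: cW; lra.
  + by apply: cvg_at_left_filter; apply: cW; lra.
Unshelve. all: by end_near. Qed.

(** * The substitution z = v_s(lambda) *)

Section time_change.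
Context (f : R -> R) (f_cont : continuous (fun z : R => f (Num.max z 0))).

Let ratio z := f (Num.max z 0) / phi (Num.max z 0).

Let ratio_cont z : 0 < z -> {for z, continuous ratio}.
Proof.
move=> z0; apply: cvgM; first exact: f_cont.
apply: cvgV; last exact: mechanism_clamp_continuous.
rewrite (max_idPl (ltW z0)) gt_eqF //; apply: lt_le_trans (mechanism_ge (ltW z0)).
exact: mulr_gt0.
Qed.

Let ratio_within x y : 0 < x -> {within `[x, y], continuous ratio}.
Proof.
move=> x0; apply: continuous_in_subspaceT => z; rewrite inE /= in_itv /= => /andP[xz _].
exact: ratio_cont (lt_le_trans x0 xz).
Qed.

Lemma ratio_measurable x y : 0 < x ->
  measurable_fun (`[x, y] : set (measurableTypeR R)) (fun z => (f z / phi z)%:E).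
Proof.
move=> x0; apply/measurable_EFinP.
apply: (@eq_measurable_fun _ _ _ _ _ ratio) => [z|].
  rewrite inE /= in_itv /= => /andP[xz _].
  by rewrite /ratio (max_idPl _) // (le_trans (ltW x0)).
by apply: subspace_continuous_measurable_fun => //; exact: ratio_within.
Qed.

Lemma cumulant_path_measurable lam (E : set R) : 0 <= lam -> E `<=` `[0, +oo[ ->
  measurable_fun (E : set (measurableTypeR R)) (fun s => (f (v s lam))%:E).
Proof.
move=> l0 E0; apply/measurable_EFinP.
apply: (@eq_measurable_fun _ _ _ _ _
  ((fun z => f (Num.max z 0)) \o (fun s => v (Num.max s 0) lam))) => [s|].
  rewrite inE => /E0; rewrite /= in_itv /= andbT => s0.
  by rewrite (max_idPl s0) (max_idPl _) // cumulant_ge0.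
apply: measurable_funTS; apply: continuous_measurable_fun => s.
apply: continuous_comp; first exact: cumulant_clamp_continuous.
exact: f_cont.
Qed.

(** Along the flow dz = - phi(z) ds. The case f = 1 measures elapsed time and serves Grey's
    condition; f = psi gives the second form of the Laplace transform of eta. *)
Lemma cumulant_time_change t lam : 0 < lam -> 0 <= t ->
  (\int[leb]_(z in `[v t lam, lam]) (f z / phi z)%:E =
   \int[leb]_(s in `[0%R, t]) (f (v s lam))%:E)%E.
Proof.
move=> l0 t0; have vt0 := cumulant_gt0 l0 t0.
transitivity (\int[leb]_(z in `[v t lam, lam]) (ratio z)%:E)%E; last first.
  rewrite cumulant_substitution //; last exact: ratio_within.
  apply: eq_integral => s; rewrite inE /= in_itv /= => /andP[s0 _].
  have vs0 := cumulant_gt0 l0 s0.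
  rewrite /ratio (max_idPl (ltW vs0)) divfK // gt_eqF //.
  by apply: lt_le_trans (mechanism_ge (ltW vs0)); exact: mulr_gt0.
apply: eq_integral => z; rewrite inE /= in_itv /= => /andP[vz _].
by rewrite /ratio (max_idPl _) // (le_trans (ltW vt0)).
Qed.

Context (f_ge0 : forall z : R, 0 <= z -> 0 <= f z).

Lemma cumulant_time_integral_cvg lam : 0 <= lam ->
  (\int[leb]_(s in `[0%R, n%:R]) (f (v s lam))%:E)%E @[n --> \oo] -->
  (\int[leb]_(s in `[0%R, +oo[) (f (v s lam))%:E)%E.
Proof.
move=> l0.
have -> : `[0, +oo[%classic = \bigcup_n `[0, n%:R]%classic :> set R.
  apply/seteqP; split => s /=; rewrite in_itv /=.
    rewrite andbT => s0; exists (Num.truncn s).+1 => //=.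
    by rewrite in_itv /= s0 ltW // truncnS_gt.
  by move=> [n _]; rewrite /= in_itv /= andbT => /andP[].
apply: ge0_nondecreasing_set_cvg_integral => //.
- move=> n k nk; apply/subsetPset => s /=; rewrite !in_itv /= => /andP[-> sn].
  by rewrite (le_trans sn) // ler_nat.
- move=> n; apply: cumulant_path_measurable => // s /=.
  by rewrite !in_itv /= andbT => /andP[].
- move=> n s; rewrite /= in_itv /= => /andP[s0 _].
  by rewrite lee_fin f_ge0 // cumulant_ge0.
Qed.

(** As v_n(lam) decreases to 0, the intervals [v_n(lam), lam] exhaust ]0, lam]; monotone convergence
    applies on both sides, and the endpoint 0 is negligible. *)
Lemma cumulant_time_change_pinfty lam : 0 < lam ->
  (\int[leb]_(s in `[0%R, +oo[) (f (v s lam))%:E =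
   \int[leb]_(z in `[0%R, lam]) (f z / phi z)%:E)%E.
Proof.
move=> l0.
have vn0 (n : nat) : 0 < v n%:R lam by apply: cumulant_gt0.
have Un : `]0, lam]%classic = \bigcup_n `[v n%:R lam, lam]%classic :> set R.
  apply/seteqP; split => z /=; rewrite in_itv /=.
    move=> /andP[z0 zl]; have bz : 0 < b * z / lam by rewrite divr_gt0 // mulr_gt0.
    (* This [n] gives v_{n+1}(lam) <= lam e^{-b(n+1)} <= lam / (b (n+1)) <= z. *)
    have [n zn] := ltr_add_invr bz; rewrite add0r in zn.
    exists n.+1 => //=; rewrite in_itv /= zl andbT.
    have := cumulant_decay (ltW l0) (lexx 0) (ler0n R n.+1).
    rewrite cumulant0 ?(ltW l0) // subr0 => /le_trans; apply.
    rewrite mulrC -ler_pdivlMr // expRN.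
    have bn0 : 0 < b * n.+1%:R by rewrite mulr_gt0.
    apply: (@le_trans _ _ (b * n.+1%:R)^-1).
      rewrite lef_pV2 ?posrE ?expR_gt0 //; apply: le_trans (expR_ge1Dx _).
      by rewrite lerDr.
    rewrite invfM -(ler_pM2l b_gt0) mulrA divff ?gt_eqF // mul1r mulrA.
    exact: ltW.
  move=> [n _]; rewrite /= in_itv /= => /andP[vz ->].
  by rewrite (lt_le_trans (vn0 n)).
have rf n : measurable_fun (`[v n%:R lam, lam] : set (measurableTypeR R))
    (fun z => (f z / phi z)%:E) by exact: ratio_measurable.
rewrite -[RHS]integral_itv_obnd_cbnd; last first.
  by rewrite Un; apply/measurable_fun_bigcup.
apply: (@cvg_unique _ _ _ _ _ _ (cumulant_time_integral_cvg (ltW l0))) => //.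
rewrite /=; under eq_cvg do rewrite -cumulant_time_change //.
rewrite Un; apply: ge0_nondecreasing_set_cvg_integral => //.
- move=> n k nk; apply/subsetPset => z /=; rewrite !in_itv /= => /andP[vz ->].
  have kn : (n%:R : R) <= k%:R by rewrite ler_nat.
  rewrite andbT (le_trans _ vz) //.
  by have /andP[] := cumulant_sub_itv (ltW l0) (ler0n R n) kn; rewrite subr_ge0.
- move=> n z; rewrite /= in_itv /= => /andP[vz _].
  have z0 : 0 <= z by rewrite (le_trans (ltW (vn0 n))).
  by rewrite lee_fin divr_ge0 ?f_ge0 ?mechanism_ge0.
Qed.

End time_change.

(* Grey's condition: it takes time r to go from lam down to v_r(lam), and the
   time spent above a high level is arbitrarily small. *)
Lemma cumulant_bounded (theta r : R) : 0 < theta -> 0 < r ->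
  (\int[leb]_(z in `[theta, +oo[) ((phi z)^-1)%:E < +oo)%E ->
  exists M : R, forall lam, 0 <= lam -> v r lam <= M.
Proof.
move=> th0 r0 fin.
have c1 : continuous (fun z : R => (cst 1 : R -> R) (Num.max z 0)).
  by move=> z; exact: cvg_cst.
have mI (x y : R) : 0 < x ->
    measurable_fun (`[x, y] : set (measurableTypeR R)) (fun z => ((phi z)^-1)%:E).
  move=> x0; have := @ratio_measurable (cst 1) c1 x y x0.
  by apply: eq_measurable_fun => z _; rewrite /= mul1r.
have iV0 (z : R) : theta <= z -> (0 <= ((phi z)^-1)%:E)%E.
  by move=> tz; rewrite lee_fin invr_ge0 mechanism_ge0 // (le_trans (ltW th0)).
pose J (x : R) := (\int[leb]_(z in `[theta, x]) ((phi z)^-1)%:E)%E.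
have mIoo : measurable_fun (`[theta, +oo[ : set (measurableTypeR R))
    (fun z => ((phi z)^-1)%:E).
  have -> : `[theta, +oo[%classic = \bigcup_n `[theta, n%:R]%classic :> set R.
    apply/seteqP; split => z /=; rewrite in_itv /=.
      rewrite andbT => tz; exists (Num.truncn z).+1 => //=.
      by rewrite in_itv /= tz ltW // truncnS_gt.
    by move=> [n _]; rewrite /= in_itv /= andbT => /andP[].
  by apply/measurable_fun_bigcup => // n; exact: mI.
have JI (x : R) : (J x <= \int[leb]_(z in `[theta, +oo[) ((phi z)^-1)%:E)%E.
  apply: ge0_subset_integral => //.
    by move=> z; rewrite /= in_itv /= andbT => /iV0.
  by apply: subset_itvl; rewrite bnd_simp.
have J0 (x : R) : (0 <= J x)%E.
  by apply: integral_ge0 => z; rewrite /= in_itv /= => /andP[/iV0].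
have Jfin (x : R) : J x \is a fin_num.
  by rewrite ge0_fin_numE //; exact: le_lt_trans (JI x) fin.
have Jmono (x y : R) : x <= y -> (J x <= J y)%E.
  move=> xy; apply: ge0_subset_integral => //; first exact: mI.
    by move=> z; rewrite /= in_itv /= => /andP[/iV0].
  by apply: subset_itvl; rewrite bnd_simp.
pose S := range (fun x => fine (J x)).
have hS : has_sup S.
  split; first by exists (fine (J 0)), 0.
  exists (fine (\int[leb]_(z in `[theta, +oo[) ((phi z)^-1)%:E)%E) => _ [x _ <-].
  rewrite fine_le // ge0_fin_numE //; exact: le_trans (J0 0) (JI 0).
(* Less than [r] of the integral of 1 / phi lies above [N]. If v_r(lam) exceeded both [N] and
   [theta], the integral from v_r(lam) to lam, which is the elapsed time [r], would be too large. *)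
have [_ [N _ <-] SN] := sup_adherent r0 hS.
exists (Num.max N theta) => lam l0; rewrite leNgt; apply/negP => Mv.
have Nv : N < v r lam by apply: le_lt_trans Mv; rewrite le_max lexx.
have tv : theta < v r lam by apply: le_lt_trans Mv; rewrite le_max lexx orbT.
have lam0 : 0 < lam.
  by apply: lt_le_trans (cumulant_le_init l0 (ltW r0)); exact: lt_trans tv.
have vl := cumulant_le_init l0 (ltW r0).
have : (J lam = J (v r lam) + r%:E)%E.
  have lr : leb (`[0, r]%classic : set R) = r%:E.
    by rewrite lebesgue_measure_itv /= lte_fin r0 sube0.
  have := cumulant_time_change c1 lam0 (ltW r0).
  under eq_integral do rewrite /= mul1r.
  have -> : (\int[leb]_(s in `[0%R, r]) (cst 1 (v s lam))%:E = r%:E)%E.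
    etransitivity; first exact: (integral_cst leb (measurable_itv `[0, r]) 1%E).
    by rewrite mul1e; exact: lr.
  move=> <-.
  have mv : measurable_fun (`]v r lam, lam] : set (measurableTypeR R))
      (fun z => ((phi z)^-1)%:E).
    by apply: measurable_funS (mI _ _ (lt_trans th0 tv)) => //; exact: subset_itv_oc_cc.
  rewrite /J -(integral_itv_obnd_cbnd mv).
  rewrite -ge0_integral_setU //.
  - by rewrite -itv_bndbnd_setU // bnd_simp // ltW.
  - by apply/measurable_funU => //; split => //; exact: mI.
  - by move=> z [] /=; rewrite in_itv /= => /andP[zt _]; apply: iV0 => //; rewrite ltW // (lt_trans tv).
  - apply/disj_setPS => z [] /=; rewrite !in_itv /= => /andP[_ zv] /andP[vz _].
    by move: vz; rewrite ltNge zv.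
have : fine (J lam) <= sup S by apply: sup_ubound; [case: hS|exists lam].
have := Jmono N (v r lam) (ltW Nv).
rewrite -(fineK (Jfin N)) -(fineK (Jfin lam)) -(fineK (Jfin (v r lam))) lee_fin.
by rewrite -EFinD => h1 h2 [Jv]; rewrite /= in h2; lra.
Qed.

End cumulant.

(** * Exponential sums and positivity of the branching semigroup *)

Section finite_sums.
Context {R : realType}.

Lemma is_derive_bigsum (I : eqType) (s : seq I) (F : I -> R -> R) (dF : I -> R) (x : R) :
  (forall i, i \in s -> is_derive x 1 (F i) (dF i)) ->
  is_derive x 1 (fun y => \sum_(i <- s) F i y) (\sum_(i <- s) dF i).
Proof.
elim: s => [_|i s IH iF].
  rewrite big_nil (_ : (fun _ => _) = cst 0); first exact: is_derive_cst.
  by apply/funext => y; rewrite big_nil.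
rewrite big_cons (_ : (fun _ => _) = F i + (fun y => \sum_(i <- s) F i y)).
  apply: is_deriveD; first by apply: iF; rewrite mem_head.
  by apply: IH => j js; apply: iF; rewrite in_cons js orbT.
by apply/funext => y; rewrite big_cons.
Qed.

Lemma cvg_bigsum (T : Type) (F : set_system T) (FF : Filter F) (I : eqType)
    (s : seq I) (f : I -> T -> R) (l : I -> R) :
  (forall i, i \in s -> f i x @[x --> F] --> l i) ->
  \sum_(i <- s) f i x @[x --> F] --> \sum_(i <- s) l i.
Proof.
elim: s => [_|i s IH fl].
  by under eq_cvg do rewrite big_nil; rewrite big_nil; exact: cvg_cst.
under eq_cvg do rewrite big_cons; rewrite big_cons; apply: cvgD.
  by apply: fl; rewrite mem_head.
by apply: IH => j js; apply: fl; rewrite in_cons js orbT.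
Qed.

Lemma integrable_bigsum d (T : measurableType d) (mu : {measure set T -> \bar R})
    (D : set T) (I : eqType) (s : seq I) (f : I -> T -> R) : measurable D ->
  (forall i, i \in s -> mu.-integrable D (EFin \o f i)) ->
  mu.-integrable D (EFin \o (fun x => \sum_(i <- s) f i x)).
Proof.
move=> mD; elim: s => [_|i s IH fi].
  by apply: eq_integrable (integrable0 _ _) => // x _ /=; rewrite big_nil.
have fi' : mu.-integrable D (EFin \o f i) by apply: fi; rewrite mem_head.
have fs : mu.-integrable D (EFin \o (fun x => \sum_(i <- s) f i x)).
  by apply: IH => j js; apply: fi; rewrite in_cons js orbT.
by apply: eq_integrable (integrableD mD fi' fs) => // x _ /=; rewrite big_cons EFinD.
Qed.

Lemma Rintegral_bigsum d (T : measurableType d) (mu : {measure set T -> \bar R})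
    (D : set T) (I : eqType) (s : seq I) (f : I -> T -> R) : measurable D ->
  (forall i, i \in s -> mu.-integrable D (EFin \o f i)) ->
  \int[mu]_(x in D) (\sum_(i <- s) f i x) = \sum_(i <- s) \int[mu]_(x in D) f i x.
Proof.
move=> mD; elim: s => [_|i s IH fi].
  under eq_Rintegral do rewrite big_nil.
  by rewrite big_nil /Rintegral integral0.
have fs j : j \in s -> mu.-integrable D (EFin \o f j).
  by move=> js; apply: fi; rewrite in_cons js orbT.
under eq_Rintegral do rewrite big_cons.
rewrite RintegralD // ?big_cons ?IH //; first by apply: fi; rewrite mem_head.
exact: integrable_bigsum.
Qed.

End finite_sums.

Section exponential_sums.
Context {R : realType}.
Implicit Types (s : seq (R * R)) (x y t h lam : R).

Definition expsum s y := \sum_(p <- s) p.1 * expR (- (p.2 * y)).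

(** For f = v_t this is the branching semigroup Q_t, acting on lists of pairs (coefficient, rate)
    rather than on the functions that they represent. *)
Definition expsum_map (f : R -> R) s := [seq (p.1, f p.2) | p <- s].

Definition nneg_rates s := all (fun p => 0 <= p.2) s.

Lemma expsum_mapE f s x :
  expsum (expsum_map f s) x = \sum_(p <- s) p.1 * expR (- (f p.2 * x)).
Proof. by rewrite /expsum big_map. Qed.

Lemma is_derive_expsum s x :
  is_derive x 1 (expsum s) (- \sum_(p <- s) p.1 * (p.2 * expR (- (p.2 * x)))).
Proof.
rewrite -sumrN; apply: is_derive_bigsum => p _.
have -> : (fun y => p.1 * expR (- (p.2 * y))) = p.1 \*: (fun y => expR (- p.2 * y)).
  by apply/funext => y; rewrite -mulNr.
apply: (is_derive_eq (is_deriveZ p.1 (is_derive_expRM (- p.2) x))).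
by rewrite /GRing.scale /= mulNr mulrN mulNr.
Qed.

Lemma expsum_continuous s : continuous (expsum s).
Proof. by move=> x; apply: is_derive_continuous (is_derive_expsum s x). Qed.

Lemma expsum_norm_le s y : nneg_rates s -> 0 <= y ->
  `|expsum s y| <= \sum_(p <- s) `|p.1|.
Proof.
move=> /allP s0 y0; rewrite (le_trans (ler_norm_sum _ _ _)) //.
rewrite big_seq [leRHS]big_seq; apply: ler_sum => p ps.
have /andP[e0 e1] := expRN_itv (mulr_ge0 (s0 _ ps) y0).
by rewrite normrM (ger0_norm e0) ler_piMr.
Qed.

Lemma expsum_second_difference s x h : expsum s (x + h) + expsum s (x - h) - 2 * expsum s x =
  \sum_(p <- s) p.1 * expR (- (p.2 * x)) *
    (expR (p.2 * (h / 2)) - expR (- p.2 * (h / 2))) ^+ 2.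
Proof.
rewrite /expsum mulr_sumr -big_split -sumrB; apply: eq_bigr => p _ /=.
have e1 : - (p.2 * (x + h)) = - (p.2 * x) + (- p.2 * (h / 2) + - p.2 * (h / 2)) by field.
have e2 : - (p.2 * (x - h)) = - (p.2 * x) + (p.2 * (h / 2) + p.2 * (h / 2)) by field.
have := expRxMexpNx_1 (p.2 * (h / 2)); rewrite -mulNr e1 e2 !expRD.
move: (expR (- p.2 * _)) (expR (p.2 * (h / 2))) (expR (- _)) => E F G FE.
transitivity (p.1 * G * (E * E + F * F - 2 * (F * E))); last by ring.
by rewrite FE; ring.
Qed.

(* Rather than Taylor's formula: symmetric second differences of exponentials
   are squares of first differences. *)
Lemma expsum_local_min_derive2_ge0 s x :
  (\forall h \near 0^'+, 2 * expsum s x <= expsum s (x + h) + expsum s (x - h)) ->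
  0 <= \sum_(p <- s) p.1 * expR (- (p.2 * x)) * p.2 ^+ 2.
Proof.
move=> xmin.
pose q (p : R * R) h := expR (p.2 * (h / 2)) - expR (- p.2 * (h / 2)).
have q' (p : R * R) : h^-1 * q p h @[h --> 0^'+] --> p.2.
  have e k : is_derive (0 : R) 1 (fun h : R => expR (k * (h / 2))) (k / 2).
    have -> : (fun h : R => expR (k * (h / 2))) = (fun h => expR (k / 2 * h)).
      by apply/funext => h; congr expR; field.
    by apply: (is_derive_eq (is_derive_expRM (k / 2) 0)); rewrite mulr0 expR0 mulr1.
  have := is_deriveB (e p.2) (e (- p.2)).
  have -> : p.2 / 2 - - p.2 / 2 = p.2 by field.
  move=> [qx qp]; apply: cvg_dnbhs_at_right.
  have := qx; rewrite /derivable => /cvg_ex[/= L qL].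
  have <- : L = p.2 by rewrite -qp; apply/esym; apply: cvg_lim qL.
  apply: cvg_trans qL; apply: near_eq_cvg; near=> h.
  rewrite /= /GRing.scale /= mulr1 addr0 /q !fctE mul0r !mulr0 expR0.
  by rewrite subrr subr0.
have lim : \sum_(p <- s) p.1 * expR (- (p.2 * x)) * (h^-1 * q p h) ^+ 2 @[h --> 0^'+]
    --> \sum_(p <- s) p.1 * expR (- (p.2 * x)) * p.2 ^+ 2.
  apply: cvg_bigsum => p _; apply: cvgMr; rewrite expr2.
  under eq_cvg do rewrite expr2.
  by apply: cvgM; exact: q'.
apply: (cvgr_to_ge lim); near=> h.
have h0 : 0 < h by near: h; exact: nbhs_right_gt.
have : 0 <= h^-1 ^+ 2 * (expsum s (x + h) + expsum s (x - h) - 2 * expsum s x).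
  by rewrite mulr_ge0 ?sqr_ge0 // subr_ge0; near: h.
rewrite expsum_second_difference mulr_sumr; congr (_ <= _).
by apply: eq_bigr => p _; rewrite /q exprMn; ring.
Unshelve. all: by end_near. Qed.

Lemma nneg_rates_map (f : R -> R) s : nneg_rates s ->
  (forall lam, 0 <= lam -> 0 <= f lam) -> nneg_rates (expsum_map f s).
Proof.
move=> /allP s0 f0; apply/allP => _ /mapP[p ps ->] /=.
exact/f0/s0.
Qed.

End exponential_sums.

(** * The maximum principle for the branching generator *)

Section branching_positivity.
Context {R : realType}.
Local Notation RM := (measurableTypeR R).
Context (b c : R) (m : {measure set RM -> \bar R}) (v : R -> R -> R).
Let phi := branching_mechanism b c m.
Context (b_gt0 : 0 < b) (c_ge0 : 0 <= c) (bm : branching_measure m).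
Context (cv : cumulant_semigroup phi v).
Implicit Types (s : seq (R * R)) (x y z t u k h lam : R).

Let phi0 : phi 0 = 0 := branching_mechanism0 b c m.
Let phi_lb y z := @branching_mechanism_lb R b c m y z bm c_ge0.
Let phi_ub y z Z := @branching_mechanism_ub R b c m y z Z bm c_ge0.

(* The generator of the branching semigroup at the state x0, divided by x0,
   satisfies the maximum principle. *)
Lemma branching_generator_ge0 s x0 k : nneg_rates s -> 0 < x0 -> 0 <= k ->
  (forall x, 0 <= x -> expsum s x0 + k * x0 <= expsum s x + k * x) ->
  0 <= \sum_(p <- s) p.1 * phi p.2 * expR (- (p.2 * x0)).
Proof.
move=> s0 x00 k0 minx.
set G' := - \sum_(p <- s) p.1 * (p.2 * expR (- (p.2 * x0))).
have G'k : G' <= - k.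
  rewrite -subr_le0 opprK.
  have kx : is_derive x0 1 (fun x => k * x) k.
    by have := is_deriveZ k (is_derive_id x0 1); rewrite [_ *: 1]mulr1.
  apply: (is_derive_left_min_le0 (is_deriveD (is_derive_expsum s x0) kx)).
  near=> y; apply: minx; apply: ltW; near: y; exact: nbhs_left_gt.
(* With G = [expsum s], this is the jump term G(x0 + u) - G(x0) - u G'(x0). Minimality of G + k x at
   [x0] bounds the difference below by - k u, and - G'(x0) >= k compensates. *)
have J0 u : 0 <= u -> 0 <= \sum_(p <- s) p.1 * expR (- (p.2 * x0)) *
    (expR (- (p.2 * u)) - 1 + p.2 * u).
  move=> u0; have -> : \sum_(p <- s) p.1 * expR (- (p.2 * x0)) *
      (expR (- (p.2 * u)) - 1 + p.2 * u) = expsum s (x0 + u) - expsum s x0 - u * G'.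
    rewrite /expsum /G' mulrN opprK mulr_sumr -sumrB -big_split /=.
    apply: eq_bigr => p _; have -> : - (p.2 * (x0 + u)) = - (p.2 * x0) + - (p.2 * u) by ring.
    by rewrite expRD; ring.
  have := minx (x0 + u) (addr_ge0 (ltW x00) u0).
  have : u * G' <= u * - k by rewrite ler_wpM2l.
  by move: (expsum s x0) (expsum s (x0 + u)) (u * G') => *; lra.
have J2 : 0 <= \sum_(p <- s) p.1 * expR (- (p.2 * x0)) * p.2 ^+ 2.
  apply: expsum_local_min_derive2_ge0; near=> h.
  have h0 : 0 <= h by apply: ltW; near: h; exact: nbhs_right_gt.
  have hx : h <= x0 by near: h; exact: nbhs_right_le.
  have := minx (x0 + h) (addr_ge0 (ltW x00) h0).
  have := minx (x0 - h); rewrite subr_ge0 => /(_ hx).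
  by move: (expsum s x0) (expsum s (x0 + h)) (expsum s (x0 - h)) => *; lra.
have Jm : \sum_(p <- s) p.1 * expR (- (p.2 * x0)) *
     \int[m]_(u in `]0, +oo[) (expR (- (p.2 * u)) - 1 + p.2 * u) =
   \int[m]_(u in `]0, +oo[) \sum_(p <- s) p.1 * expR (- (p.2 * x0)) *
     (expR (- (p.2 * u)) - 1 + p.2 * u).
  have pi p : p \in s -> m.-integrable `]0, +oo[
      (EFin \o (fun u : R => expR (- (p.2 * u)) - 1 + p.2 * u)).
    by move=> ps; apply: branching_integrable => //; exact: (allP s0).
  rewrite Rintegral_bigsum //.
    rewrite big_seq [RHS]big_seq; apply: eq_bigr => p ps.
    by rewrite RintegralZl //; exact: pi.
  move=> p ps; have := integrableZl _ (p.1 * expR (- (p.2 * x0))) (pi p ps).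
  exact.
(* The generator splits into drift - b G', diffusion c G'' and a jump integral; each is nonnegative
   at the minimum. *)
have -> : \sum_(p <- s) p.1 * phi p.2 * expR (- (p.2 * x0)) = b * - G'
   + c * (\sum_(p <- s) p.1 * expR (- (p.2 * x0)) * p.2 ^+ 2)
   + \int[m]_(u in `]0, +oo[) \sum_(p <- s) p.1 * expR (- (p.2 * x0)) *
     (expR (- (p.2 * u)) - 1 + p.2 * u).
  rewrite -Jm /G' opprK !mulr_sumr -!big_split; apply: eq_bigr => p _ /=.
  rewrite /phi /branching_mechanism.
  by move: (\int[_]_(_ in _) _) (expR _); intros; ring.
apply: addr_ge0; first apply: addr_ge0.
- by rewrite mulr_ge0 ?(ltW b_gt0) //; lra.
- exact: mulr_ge0.
- by apply: Rintegral_ge0 => u; rewrite /= in_itv /= andbT => /ltW /J0.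
Unshelve. all: by end_near. Qed.

(* A negative value of G(t, x), the image of the exponential sum under the
   branching semigroup, gives G + k t + k x a negative minimum for small k; there
   the time derivative cannot be positive, although the generator is nonnegative. *)
Lemma branching_positive s t x : nneg_rates s -> 0 <= t -> 0 <= x ->
  (forall y, 0 <= y -> 0 <= expsum s y) -> 0 <= expsum (expsum_map (v t) s) x.
Proof.
move=> s0 t0 x0 sge0; rewrite leNgt; apply/negP => neg.
pose G t x := expsum (expsum_map (v t) s) x.
have vs0 u : 0 <= u -> nneg_rates (expsum_map (v u) s).
  by move=> u0; apply: nneg_rates_map => // l l0; exact: (cumulant_ge0 cv).
(* With this [k], G t x + k t + k x = - k (t + x + 2) < 0. *)
pose k := - G t x / (2 * (t + x + 1)).
have k0 : 0 < k by rewrite divr_gt0 ?oppr_gt0 //; lra.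
pose f (p : R * R) := G (Num.max p.1 0) p.2 + k * p.1 + k * p.2.
have ftx : f (t, x) < 0.
  rewrite /f /= (max_idPl t0).
  have -> : G t x = - (k * (2 * (t + x + 1))) by rewrite /k; field; lra.
  by nra.
pose C := \sum_(p <- s) `|p.1|.
have C0 : 0 <= C by apply: sumr_ge0.
have GC u y : 0 <= u -> 0 <= y -> - C <= G u y.
  move=> u0 y0; have := expsum_norm_le (vs0 _ u0) y0.
  by rewrite big_map /= => /ler_normlP[+ _]; rewrite lerNl.
(* As G >= - C, the term k y makes [f] positive beyond C / k; so the minimum over [0, t] x [0, X],
   being negative, is minimal over all states at its own time. *)
pose X := x + C / k + 1.
have Ck : 0 <= C / k by rewrite divr_ge0 // ltW.
have fX u y : 0 <= u -> X <= y -> 0 < f (u, y).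
  move=> u0 Xy; have y0 : 0 <= y by apply: le_trans Xy; rewrite /X; lra.
  rewrite /f /= (max_idPl u0); have := GC u y u0 y0.
  have : C < k * y.
    by rewrite mulrC -ltr_pdivrMr //; apply: lt_le_trans Xy; rewrite /X; lra.
  by have := mulr_ge0 (ltW k0) u0; lra.
have fc : continuous f.
  move=> p; apply: cvgD; first apply: cvgD.
  - rewrite /G; under eq_cvg do rewrite expsum_mapE.
    rewrite expsum_mapE; apply: cvg_bigsum => q qs; apply: cvgMr.
    apply: continuous_comp; last exact: continuous_expR.
    apply: cvgN; apply: cvgM; last exact: cvg_snd.
    apply: (@continuous_comp _ _ _ fst (fun t => v (Num.max t 0) q.2)).
      exact: cvg_fst.
    apply: (cumulant_clamp_continuous b_gt0 phi0 phi_lb cv).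
    exact: (allP s0).
  - by apply: cvgMr; exact: cvg_fst.
  - by apply: cvgMr; exact: cvg_snd.
have X0 : 0 <= X by rewrite /X; lra.
pose A : set (R * R) := `[0, t] `*` `[0, X].
have Atx : A (t, x) by rewrite /A /= !in_itv /= t0 lexx x0 /X; lra.
have cA : compact A by apply: compact_setX; exact: segment_compact.
have [[t1 x1] /[!inE]] := compact_EVT_min (ex_intro _ _ Atx) cA (continuous_subspaceT fc).
rewrite /A /= !in_itv /= => -[/andP[t10 t1t] /andP[x10 x1X]] min1.
have f1 : f (t1, x1) < 0 by apply: le_lt_trans ftx; apply: min1; rewrite inE.
have minx y : 0 <= y -> f (t1, x1) <= f (t1, y).
  move=> y0; have [yX|/ltW Xy] := leP y X.
    by apply: min1; rewrite inE /= !in_itv /= t10 t1t y0.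
  by apply/ltW/(lt_trans f1)/fX.
(* At time 0, G is the nonnegative initial sum. At state 0, treated next, all exponentials are 1 and
   G keeps the initial value at 0. The negative minimum thus avoids both edges. *)
have t1_gt0 : 0 < t1.
  rewrite lt0r t10 andbT; apply/eqP => t1E; move: f1.
  rewrite ltNge => /negP; apply; rewrite /f t1E /= maxxx mulr0 addr0.
  apply: addr_ge0; last by rewrite mulr_ge0 // ltW.
  rewrite /G expsum_mapE big_seq; under eq_bigr => p ps.
    rewrite (cumulant0 cv); last exact: (allP s0).
    over.
  by rewrite -big_seq; exact: sge0.
have x1_gt0 : 0 < x1.
  rewrite lt0r x10 andbT; apply/eqP => x1E; move: f1.
  rewrite ltNge => /negP; apply; rewrite /f x1E /= mulr0 addr0.
  apply: addr_ge0; last by rewrite mulr_ge0 // ltW.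
  suff -> : G (Num.max t1 0) 0 = expsum s 0 by exact: sge0.
  by rewrite /G expsum_mapE; apply: eq_bigr => p _; rewrite !mulr0.
have gen : 0 <= \sum_(p <- expsum_map (v t1) s) p.1 * phi p.2 * expR (- (p.2 * x1)).
  apply: (@branching_generator_ge0 _ _ k) => //; [exact: vs0|exact: ltW|].
  move=> y y0; have := minx y y0.
  by rewrite /f /= (max_idPl t10) -/(G _ _) -/(G _ _); lra.
rewrite big_map /= in gen.
(* Because dv_t/dt = - phi(v_t), the left side is the time derivative of [f] at the minimum: [x1]
   times a nonnegative sum, plus k > 0. Minimality against earlier times forces it to be <= 0. *)
suff : x1 * (\sum_(p <- s) p.1 * phi (v t1 p.2) * expR (- (v t1 p.2 * x1))) + k <= 0.
  by rewrite leNgt => /negP; apply; rewrite ltr_wpDl // mulr_ge0.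
have kd : is_derive t1 1 (fun u => k * u) k.
  by have := is_deriveZ k (is_derive_id t1 1); rewrite [_ *: 1]mulr1.
have Gd : is_derive t1 1 (fun u => \sum_(p <- s) p.1 * expR (- x1 * v u p.2))
   (\sum_(p <- s) p.1 * (x1 * phi (v t1 p.2) * expR (- x1 * v t1 p.2))).
  apply: is_derive_bigsum => p ps.
  have vd := is_derive_cumulant b_gt0 phi0 phi_lb phi_ub cv (allP s0 _ ps) t1_gt0.
  apply: (is_derive_eq (is_deriveZ p.1
    (is_derive1_comp (is_derive_expRM (- x1) (v t1 p.2)) vd))).
  by rewrite /GRing.scale /=; ring.
have := is_derive_left_min_le0 (is_deriveD Gd kd).
rewrite mulr_sumr; under eq_bigr => p _.
  rewrite (_ : _ * _ = x1 * (p.1 * phi (v t1 p.2) * expR (- (v t1 p.2 * x1)))); last first.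
    by rewrite mulNr (mulrC (v _ _)); ring.
  over.
apply; near=> u.
have u0 : 0 < u by near: u; exact: nbhs_left_gt.
have ut1 : u <= t1 by near: u; exact: nbhs_left_le.
have /min1 : (u, x1) \in A.
  by rewrite inE /A /= !in_itv /= (ltW u0) (le_trans ut1) // x10 x1X.
rewrite /f /= (max_idPl t10) (max_idPl (ltW u0)) lerD2r /G !expsum_mapE.
have E w : \sum_(p <- s) p.1 * expR (- (v w p.2 * x1)) =
    \sum_(p <- s) p.1 * expR (- x1 * v w p.2).
  by apply: eq_bigr => p _; rewrite mulNr [x1 * _]mulrC.
by rewrite (E t1) (E u).
Unshelve. all: by end_near. Qed.

End branching_positivity.

(** * Lipschitz dependence on the initial state *)

Lemma integrable_norm_le d (T : measurableType d) (R : realType)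
    (mu : {measure set T -> \bar R}) (D : set T) (f : T -> R) (M : R) :
  measurable D -> (mu D < +oo)%E -> measurable_fun D f ->
  (forall x, D x -> `|f x| <= M) -> mu.-integrable D (EFin \o f).
Proof.
move=> mD Dlty mf fM; apply: measurable_bounded_integrable => //.
by exists M; split; [exact: num_real|move=> x Mx y Dy]; exact: le_trans (fM y Dy) (ltW Mx).
Qed.

Section laplace_expsum.
Context {R : realType}.
Local Notation RM := (measurableTypeR R).
Context (mu : {measure set RM -> \bar R}) (L : R -> R).
Context (laplaceE : forall lam : R, 0 <= lam -> laplace mu lam = (L lam)%:E).
Implicit Types (s : seq (R * R)) (lam : R).

Lemma laplace_integrable lam : 0 <= lam ->
  mu.-integrable `[0, +oo[ (EFin \o (fun y : R => expR (- (lam * y)))).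
Proof.
move=> l0; apply/integrableP; split.
  apply/measurable_EFinP; have := @measurable_affine_expR R `[0, +oo[ 1 0 0 lam.
  by apply: eq_measurable_fun => u _; ring.
under eq_integral do rewrite /= ger0_norm ?expR_ge0 //.
by have := laplaceE l0; rewrite /laplace => ->; rewrite ltry.
Qed.

Let pi s : nneg_rates s -> forall p, p \in s -> mu.-integrable `[0, +oo[
  (EFin \o (fun y : R => p.1 * expR (- (p.2 * y)))).
Proof.
move=> /allP s0 p ps; have := integrableZl _ p.1 (laplace_integrable (s0 _ ps)).
exact.
Qed.

Lemma expsum_integrable s : nneg_rates s ->
  mu.-integrable `[0, +oo[ (EFin \o expsum s).
Proof. by move=> s0; apply: integrable_bigsum => // p; exact: pi. Qed.

Lemma Rintegral_expsum s : nneg_rates s ->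
  \int[mu]_(y in `[0, +oo[) expsum s y = \sum_(p <- s) p.1 * L p.2.
Proof.
move=> s0; rewrite /expsum Rintegral_bigsum //; last by move=> p; exact: pi.
rewrite big_seq [RHS]big_seq; apply: eq_bigr => p ps.
have p0 := allP s0 _ ps.
rewrite RintegralZl //; last exact: laplace_integrable.
by have := laplaceE p0; rewrite /laplace /Rintegral => ->.
Qed.

End laplace_expsum.

Section coupling.
Context {R : realType}.
Local Notation RM := (measurableTypeR R).
Context (b c : R) (m : {measure set RM -> \bar R}) (v : R -> R -> R).
Local Notation phi := (branching_mechanism b c m).
Context (b_gt0 : 0 < b) (c_ge0 : 0 <= c) (bm : branching_measure m).
Context (cv : cumulant_semigroup phi v).
Implicit Types (s : seq (R * R)) (x y z t u k h lam mu theta r V : R).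

(** A diagonal action on the coefficients: weights e^{-l z} translate the sum by z, constant weights
    scale it, and weights e^{-x v_t(l)} absorb a first portion x of the initial state. *)
Definition expsum_weight (w : R -> R) s := [seq (p.1 * w p.2, p.2) | p <- s].

Lemma nneg_rates_weight w s : nneg_rates (expsum_weight w s) = nneg_rates s.
Proof. by rewrite /nneg_rates all_map. Qed.

Lemma expsum_shift s y z :
  expsum (expsum_weight (fun l => expR (- (l * z))) s) y = expsum s (z + y).
Proof.
rewrite /expsum big_map; apply: eq_bigr => p _ /=.
by rewrite -mulrA -expRD; congr (_ * expR _); ring.
Qed.

Lemma expsum_cons (p : R * R) s y :
  expsum (p :: s) y = p.1 * expR (- (p.2 * y)) + expsum s y.
Proof. by rewrite /expsum big_cons. Qed.

Lemma expsum_scale k s y : expsum (expsum_weight (fun=> k) s) y = k * expsum s y.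
Proof. by rewrite /expsum big_map mulr_sumr; apply: eq_bigr => p _ /=; ring. Qed.

Lemma expsum_map_weight (f w : R -> R) s y :
  expsum (expsum_map f (expsum_weight w s)) y =
  \sum_(p <- s) p.1 * w p.2 * expR (- (f p.2 * y)).
Proof. by rewrite /expsum !big_map. Qed.

(** Positivity is applied to H and to 1 - H; the constant 1 is the pair (1, 0), which is fixed
    because v_t(0) = 0. *)
Lemma branching_contraction s t x : nneg_rates s -> 0 <= t -> 0 <= x ->
  (forall y, 0 <= y -> 0 <= expsum s y <= 1) ->
  0 <= expsum (expsum_map (v t) s) x <= 1.
Proof.
move=> s0 t0 x0 s01; apply/andP; split.
  apply: (branching_positive b_gt0 c_ge0 bm cv) => // y y0.
  by have /andP[] := s01 y y0.
have := @branching_positive _ b c m v b_gt0 c_ge0 bm cv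
  ((1, 0) :: expsum_weight (fun=> -1) s) t x.
rewrite /= lexx nneg_rates_weight => /(_ s0 t0 x0).
rewrite expsum_cons /= expsum_map_weight expsum_mapE.
have v0 : v t 0 = 0.
  apply/le_anti/andP; split; last exact: (cumulant_ge0 cv).
  apply: (cumulant_le_init b_gt0 (branching_mechanism0 _ _ _) _ cv) => //.
  by move=> y z; exact: branching_mechanism_lb.
rewrite v0 mul0r oppr0 expR0 mulr1.
under eq_bigr do rewrite mulrN1 mulNr.
rewrite sumrN subr_ge0; apply=> y y0.
rewrite expsum_cons expsum_scale /= mul0r oppr0 expR0 mulr1 mulN1r subr_ge0.
by have /andP[] := s01 y y0.
Qed.

(* This replaces a coupling of the branching process started at x and x + h. By
   the branching property the image at x + h is that at h of an exponential sum H
   with values in [0, 1] and H 0 the image at x. As |H z - H 0| <= 1 - e^{-l z} + e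
   for l large, positivity bounds the difference by 1 - e^{-h v_t(l)} + e. *)
Lemma branching_lipschitz s t x h V : nneg_rates s -> 0 <= t -> 0 <= x -> 0 <= h ->
  (forall lam, 0 <= lam -> v t lam <= V) ->
  (forall y, 0 <= y -> 0 <= expsum s y <= 1) ->
  `|expsum (expsum_map (v t) s) (x + h) - expsum (expsum_map (v t) s) x| <= h * V.
Proof.
move=> s0 t0 x0 h0 vV s01.
(* H(y) is the image at [x] of the sum translated by y, hence lies in [0, 1]. Splitting e^{-(x+h)
   v_t} as a product turns the image of [s] at x + h into the image of H at h. *)
pose H := expsum_weight (fun l => expR (- (v t l * x))) s.
have H0 : nneg_rates H by rewrite nneg_rates_weight.
have H01 y : 0 <= y -> 0 <= expsum H y <= 1.
  move=> y0.
  have -> : expsum H y = expsum (expsum_map (v t)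
      (expsum_weight (fun l => expR (- (l * y))) s)) x.
    rewrite expsum_map_weight /expsum big_map; apply: eq_bigr => p _ /=; ring.
  apply: branching_contraction; rewrite ?nneg_rates_weight // => u u0.
  by rewrite expsum_shift; apply: s01; rewrite addr_ge0.
have -> : expsum (expsum_map (v t) s) x = expsum H 0.
  rewrite expsum_mapE /expsum big_map; apply: eq_bigr => p _ /=.
  by rewrite mulr0 oppr0 expR0 mulr1.
have -> : expsum (expsum_map (v t) s) (x + h) = expsum (expsum_map (v t) H) h.
  rewrite expsum_mapE expsum_map_weight; apply: eq_bigr => p _ /=.
  by rewrite -mulrA -expRD; congr (_ * expR _); ring.
pose L := \sum_(p <- H) `|p.1| * p.2.
have L0 : 0 <= L.
  rewrite /L big_seq; apply: sumr_ge0 => p pH; rewrite mulr_ge0 //.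
  exact: (allP H0).
have HL y : 0 <= y -> `|expsum H 0 - expsum H y| <= L * y.
  move=> y0; rewrite /expsum -sumrB (le_trans (ler_norm_sum _ _ _)) //.
  rewrite /L mulr_suml big_seq [leRHS]big_seq; apply: ler_sum => p pH.
  have p0 := allP H0 _ pH.
  rewrite mulr0 oppr0 expR0 -mulrBr normrM -mulrA ler_wpM2l //.
  have /andP[_ e1] := expRN_itv (mulr_ge0 p0 y0).
  rewrite ger0_norm ?subr_ge0 //; have := expRN_ge1B (p.2 * y).
  by lra.
rewrite distrC; apply/ler_addgt0Pr => e e0.
(* Up to [d] the Lipschitz constant [L] of H keeps the variation below [e]; beyond it, l = 1 / (e d)
   makes e^{-l y} <= 1 / (l d) = e, so that the trivial bound 1 suffices. *)
pose d := e / (L + 1).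
have d0 : 0 < d by rewrite divr_gt0 // ltr_wpDl.
pose l := (e * d)^-1.
have l0 : 0 < l by rewrite invr_gt0 mulr_gt0.
have le0 := ltW l0.
have Hl y : 0 <= y -> `|expsum H 0 - expsum H y| <= 1 - expR (- (l * y)) + e.
  move=> y0; have /andP[_ e1] := expRN_itv (mulr_ge0 le0 y0).
  have [yd|dy] := leP y d.
    have : L * y <= e.
      apply: (@le_trans _ _ ((L + 1) * d)).
        by rewrite ler_pM // lerDl.
      by rewrite /d mulrC divfK // gt_eqF // ltr_wpDl.
    by have := HL y y0; lra.
  have : expR (- (l * y)) <= e.
    rewrite expRN invf_ple ?posrE ?expR_gt0 //.
    apply: (@le_trans _ _ (1 + l * y)); last exact: expR_ge1Dx.
    rewrite ler_wpDl //; have -> : e^-1 = l * d.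
      by rewrite /l; field; rewrite !gt_eqF.
    by rewrite ler_wpM2l // ltW.
  have /andP[a0 a1] := H01 0 (lexx 0); have /andP[b0 b1] := H01 y y0.
  have : `|expsum H 0 - expsum H y| <= 1 by rewrite ler_norml; apply/andP; split; lra.
  by lra.
(* The barrier e + 1 - e^{-l y} + k (H(0) - H(y)) is nonnegative by [Hl], and is itself an
   exponential sum; the two signs of [k] give the two sides of the absolute value. *)
have main k : (k = 1 \/ k = -1) ->
    0 <= e + 1 + k * expsum H 0 - expR (- (v t l * h)) - k * expsum (expsum_map (v t) H) h.
  move=> k1; have := @branching_positive _ b c m v b_gt0 c_ge0 bm cv
    [:: (e + 1 + k * expsum H 0, 0), (-1, l) & expsum_weight (fun=> - k) H] t h.
  rewrite /= lexx le0 nneg_rates_weight => /(_ H0 t0 h0).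
  rewrite !expsum_cons /= expsum_map_weight expsum_mapE.
  have v0 : v t 0 = 0.
    apply/le_anti/andP; split; last exact: (cumulant_ge0 cv).
    apply: (cumulant_le_init b_gt0 (branching_mechanism0 _ _ _) _ cv) => //.
    by move=> y z; exact: branching_mechanism_lb.
  rewrite v0 mul0r oppr0 expR0 mulr1 mulN1r.
  have -> : \sum_(p <- H) p.1 * - k * expR (- (v t p.2 * h)) =
      - (k * \sum_(p <- H) p.1 * expR (- (v t p.2 * h))).
    by rewrite mulr_sumr -sumrN; apply: eq_bigr => p _; ring.
  rewrite addrA; apply=> y y0.
  rewrite !expsum_cons expsum_scale /= mul0r oppr0 expR0 mulr1 mulN1r.
  by have := Hl y y0; rewrite ler_norml => /andP[]; case: k1 => ->; lra.
have m1 := main 1 (or_introl erefl); have m2 := main (-1) (or_intror erefl).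
have : 1 - expR (- (v t l * h)) <= h * V.
  have := expRN_ge1B (v t l * h).
  have : v t l * h <= h * V by rewrite mulrC ler_wpM2l // vV.
  by lra.
by move=> hV; rewrite ler_norml; apply/andP; split; lra.
Qed.

Lemma CBI_expsum_lipschitz (psi : R -> R) (P : R -> R.-pker RM ~> RM) s t x h V :
  CBI_semigroup psi v P -> nneg_rates s -> 0 <= t -> 0 <= x -> 0 <= h ->
  (forall lam, 0 <= lam -> v t lam <= V) ->
  (forall y, 0 <= y -> 0 <= expsum s y <= 1) ->
  `|\int[P t (x + h)]_(y in `[0, +oo[) expsum s y -
    \int[P t x]_(y in `[0, +oo[) expsum s y| <= h * V.
Proof.
move=> [[P1 _] PL] s0 t0 x0 h0 vV s01.
pose g lam := expR (- \int[lebesgue_measure]_(r in `[0, t]) psi (v r lam)).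
have PLE y lam : 0 <= y -> 0 <= lam ->
    laplace (P t y) lam = (expR (- (v t lam * y)) * g lam)%:E.
  by move=> y0 l0; rewrite PL // expRD (mulrC y).
rewrite (Rintegral_expsum (PLE _ ^~ (addr_ge0 x0 h0))) //.
rewrite (Rintegral_expsum (PLE _ ^~ x0)) //.
(* K(z) is the difference of the images at x + h and at x of the sum translated by z. Since [g] is
   the Laplace transform of P_t(0, .), integrating K against that law restores the immigration
   factor. *)
pose K := expsum_weight (fun l => expR (- (v t l * (x + h))) - expR (- (v t l * x))) s.
have K0 : nneg_rates K by rewrite nneg_rates_weight.
have g0 lam : 0 <= lam -> laplace (P t 0) lam = (g lam)%:E.
  by move=> l0; rewrite PLE // mulr0 oppr0 expR0 mul1r.
have -> : \sum_(p <- s) p.1 * (expR (- (v t p.2 * (x + h))) * g p.2) -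
    \sum_(p <- s) p.1 * (expR (- (v t p.2 * x)) * g p.2) =
    \int[P t 0]_(z in `[0, +oo[) expsum K z.
  rewrite (Rintegral_expsum g0) // big_map -sumrB; apply: eq_bigr => p _ /=.
  by ring.
have Ki := expsum_integrable g0 K0.
apply: (le_trans (le_normr_Rintegral _ Ki)) => //.
have -> : h * V = \int[P t 0]_(z in `[0, +oo[) (h * V).
  by rewrite Rintegral_cst // [P t 0 _]P1 // mulr1.
apply: le_Rintegral => //.
- exact: integrable_norm.
- apply: (@integrable_norm_le _ _ _ _ _ _ `|h * V|) => //.
  by rewrite [P t 0 _]P1 // ltry.
- move=> z; rewrite /= in_itv /= andbT => z0.
  have -> : expsum K z =
      expsum (expsum_map (v t) (expsum_weight (fun l => expR (- (l * z))) s)) (x + h)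
      - expsum (expsum_map (v t) (expsum_weight (fun l => expR (- (l * z))) s)) x.
    rewrite !expsum_map_weight /expsum big_map -sumrB; apply: eq_bigr => p _ /=.
    by ring.
  apply: branching_lipschitz; rewrite ?nneg_rates_weight // => y y0.
  by rewrite expsum_shift; apply: s01; rewrite addr_ge0.
Qed.

(** Positivity at state 1 of the image of e^{-lam y} - e^{-mu y} compares the two solutions of the
    differential equation. *)
Lemma cumulant_nondecreasing t lam mu : 0 <= t -> 0 <= lam -> lam <= mu ->
  v t lam <= v t mu.
Proof.
move=> t0 l0 lm; have m0 := le_trans l0 lm.
have : 0 <= expsum (expsum_map (v t) [:: (1, lam); (-1, mu)]) 1.
  apply: (branching_positive b_gt0 c_ge0 bm cv) => //; first by rewrite /= l0 m0.
  move=> y y0; rewrite /expsum big_cons big_seq1 /= mul1r mulN1r subr_ge0.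
  by rewrite ler_expR lerN2 ler_wpM2r.
rewrite expsum_mapE big_cons big_seq1 /= !mulr1 mul1r mulN1r subr_ge0.
by rewrite ler_expR lerN2.
Qed.

Lemma cumulant_limit_fin theta r : 0 < theta -> 0 < r ->
  (\int[lebesgue_measure]_(z in `[theta, +oo[) ((phi z)^-1)%:E < +oo)%E ->
  exists2 V, cumulant_limit v r = V%:E & forall lam, 0 <= lam -> v r lam <= V.
Proof.
move=> th0 r0 grey; have r0' := ltW r0.
have [M vM] := cumulant_bounded b_gt0 (branching_mechanism0 b c m)
  (fun y z => @branching_mechanism_lb R b c m y z bm c_ge0)
  (fun y z Z => @branching_mechanism_ub R b c m y z Z bm c_ge0) cv th0 r0 grey.
pose f lam := v r (Num.max lam 0).
have fub : has_ubound (range f).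
  by exists M => _ [lam _ <-]; apply: vM; rewrite le_max lexx orbT.
have fnd : {homo f : x y / x <= y}.
  move=> x y xy; apply: cumulant_nondecreasing => //; first by rewrite le_max lexx orbT.
  by rewrite ge_max !le_max lexx xy orbT.
exists (sup (range f)).
  rewrite /cumulant_limit; apply/cvg_lim => //.
  apply: cvg_EFin; first exact: nearW.
  apply: cvg_trans (nondecreasing_cvgr fnd fub); apply: near_eq_cvg.
  near=> lam; rewrite /f (max_idPl _) //; near: lam; exact: nbhs_pinfty_ge.
move=> lam l0; apply: ub_le_sup => //; exists lam => //.
by rewrite /f (max_idPl l0).
Unshelve. all: by end_near. Qed.

Lemma cumulant_bound_decay r t V : 0 <= r -> r <= t ->
  (forall lam, 0 <= lam -> v r lam <= V) ->
  forall lam, 0 <= lam -> v t lam <= V * expR (b * (r - t)).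
Proof.
move=> r0 rt vV lam l0.
apply: (le_trans (cumulant_decay b_gt0 (branching_mechanism0 b c m)
  (fun y z => @branching_mechanism_lb R b c m y z bm c_ge0)
  (fun y z Z => @branching_mechanism_ub R b c m y z Z bm c_ge0) cv l0 r0 rt)).
have -> : - (b * (t - r)) = b * (r - t) by ring.
by rewrite ler_wpM2r ?expR_ge0 // vV.
Qed.

End coupling.

(** * Density of exponential sums *)

Section unit_functions.
Context {R : realType}.
Local Notation RM := (measurableTypeR R).
Local Notation D := (`[0, +oo[%classic : set R).
Implicit Types (f g : R -> R).

Lemma unit_integrable (mu : {measure set RM -> \bar R}) f : (mu D < +oo)%E ->
  measurable_fun (D : set RM) f -> (forall y : R, 0 <= y -> 0 <= f y <= 1) ->
  mu.-integrable D (EFin \o f).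
Proof.
move=> muD mf f1; apply: (@integrable_norm_le _ _ _ _ _ _ 1) => //.
move=> y; rewrite /= in_itv /= andbT => /f1 /andP[? ?].
by rewrite ger0_norm.
Qed.

(** One step of the binary expansion: B = {f >= 1/2} carries the first digit of f, and g = 2 f - 1_B
    the remaining ones. *)
Lemma dyadic_split f : measurable_fun (D : set RM) f ->
  (forall y : R, 0 <= y -> 0 <= f y <= 1) ->
  exists (B : set RM) (g : R -> R), [/\ measurable B, B `<=` D,
    measurable_fun (D : set RM) g, forall y : R, 0 <= y -> 0 <= g y <= 1
    & forall y : R, 0 <= y -> f y = (\1_B y + g y) / 2].
Proof.
move=> mf f1; pose B : set R := D `&` [set y | 1 / 2 <= f y].
have mB : measurable (B : set RM).
  have -> : B = D `&` f @^-1` `[1 / 2, +oo[.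
    by congr (_ `&` _); apply/seteqP; split => y /=; rewrite in_itv /= andbT.
  exact: mf.
exists B, (fun y => 2 * f y - \1_B y); split => //.
- by move=> y [].
- apply: measurable_funB; first exact: measurable_funM.
  by apply: measurable_funTS; exact: measurable_indic.
- move=> y y0.
  have -> : \1_B y = (1 / 2 <= f y)%R%:R :> R.
    rewrite indicE; congr (_%:R); congr nat_of_bool.
    apply/idP/idP; rewrite inE; first by case.
    by move=> gy; split => //=; rewrite in_itv /= andbT.
  have /andP[? ?] := f1 y y0.
  by have [?|?] := leP (1 / 2) (f y); apply/andP; split; rewrite /=; lra.
- by move=> y _; field.
Qed.

(** If the error is at most K + 2^-n for every g, one binary digit more gives (K + K + 2^-n) / 2 = K
    + 2^-(n+1). Averaging thus keeps the constant K of the sets. *)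
Lemma measure_dist_sets (mu1 mu2 : {measure set RM -> \bar R}) (K : R) f :
  (mu1 D <= 1)%E -> (mu2 D <= 1)%E ->
  (forall A : set RM, measurable A -> A `<=` D ->
    `|fine (mu1 A) - fine (mu2 A)| <= K) ->
  measurable_fun (D : set RM) f -> (forall y : R, 0 <= y -> 0 <= f y <= 1) ->
  `|\int[mu1]_(y in D) f y - \int[mu2]_(y in D) f y| <= K.
Proof.
move=> le1 le2 muK mf f1.
have fin1 : (mu1 D < +oo)%E by apply: le_lt_trans le1 (ltry _).
have fin2 : (mu2 D < +oo)%E by apply: le_lt_trans le2 (ltry _).
have K0 : 0 <= K.
  by have := muK set0 measurable0 (@sub0set _ _); rewrite !measure0 subrr normr0.
pose E g := \int[mu1]_(y in D) g y - \int[mu2]_(y in D) g y.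
have unit_le (mu : {measure set RM -> \bar R}) g : (mu D <= 1)%E ->
    measurable_fun (D : set RM) g -> (forall y : R, 0 <= y -> 0 <= g y <= 1) ->
    0 <= \int[mu]_(y in D) g y <= 1.
  move=> muD mg g1; have muDlt : (mu D < +oo)%E by apply: le_lt_trans muD (ltry _).
  have g01 y : D y -> 0 <= g y <= 1 by rewrite /= in_itv /= andbT; exact: g1.
  apply/andP; split; first by apply: Rintegral_ge0 => y /g01 /andP[].
  apply: (@le_trans _ _ (\int[mu]_(y in D) 1)).
    apply: le_Rintegral => //; first exact: unit_integrable.
      by apply: unit_integrable => // y _; rewrite ler01 lexx.
    by move=> y /g01 /andP[].
  rewrite Rintegral_cst // mul1r -[1]/(fine 1%E) fine_le //.
  by rewrite ge0_fin_numE.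
suff H n : forall g, measurable_fun (D : set RM) g ->
    (forall y : R, 0 <= y -> 0 <= g y <= 1) -> `|E g| <= K + 2^-1 ^+ n.
  apply: (@cvgr_to_ge _ \oo _ _ (fun n => K + 2^-1 ^+ n)); last first.
    by near=> n; exact: H.
  rewrite -[X in _ --> X]addr0; apply: cvgD; first exact: cvg_cst.
  by apply: cvg_expr; rewrite ger0_norm //; lra.
elim: n => [|n IH] g mg g1.
  have /andP[? ?] := unit_le _ _ le1 mg g1; have /andP[? ?] := unit_le _ _ le2 mg g1.
  by rewrite expr0 /E ler_norml; apply/andP; split; lra.
have [B [h [mB BD mh h1 gE]]] := dyadic_split mg g1.
have mB1 : measurable_fun (D : set RM) (\1_B : R -> R).
  by apply: measurable_funTS; exact: measurable_indic.
have B1 (y : R) : 0 <= y -> 0 <= (\1_B y : R) <= 1.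
  by move=> _; rewrite indicE; case: (_ \in _); rewrite /= ?ler01 ?lexx.
have intE (mu : {measure set RM -> \bar R}) : (mu D < +oo)%E ->
    \int[mu]_(y in D) g y = 2^-1 * (fine (mu B) + \int[mu]_(y in D) h y).
  move=> muD; have Bi := unit_integrable muD mB1 B1; have hi := unit_integrable muD mh h1.
  have -> : fine (mu B) = \int[mu]_(y in D) (\1_B y : R).
    by rewrite /Rintegral integral_indic // setIC setIidr.
  rewrite -RintegralD // -RintegralZl //; last exact: (integrableD _ Bi hi).
  apply: eq_Rintegral => y; rewrite inE /= in_itv /= andbT => y0.
  by rewrite gE // mulrC.
rewrite /E !intE // -mulrBr.
have := muK B mB BD; have := IH h mh h1; rewrite /E exprS.
move: (fine (mu1 B)) (fine (mu2 B)) (\int[mu1]_(y in D) h y) (\int[mu2]_(y in D) h y).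
move: (2^-1 ^+ n) => p a1 a2 b1 b2.
by rewrite !ler_norml => /andP[? ?] /andP[? ?]; apply/andP; split; lra.
Unshelve. all: by end_near. Qed.

End unit_functions.

Section expsum_density.
Context {R : realType}.
Local Notation RM := (measurableTypeR R).
Local Notation D := (`[0, +oo[%classic : set R).
Context (mu : {measure set RM -> \bar R}) (mu_fin : (mu D < +oo)%E).
Implicit Types (s : seq (R * R)) (f g : R -> R) (A : set RM).

Let unit_on f := forall y : R, 0 <= y -> 0 <= f y <= 1.

(** The L^1 closure of exponential sums with values in [0, 1]. The approximants must satisfy these
    bounds themselves, since the Lipschitz estimate holds only for such sums. *)
Definition expsum_approx f :=
  [/\ measurable_fun (D : set RM) f, unit_on f & forall e, 0 < e ->
    exists s, [/\ nneg_rates s, unit_on (expsum s) &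
      \int[mu]_(y in D) `|f y - expsum s y| <= e]].

Lemma expsum_measurable s (E : set RM) : measurable_fun E (expsum s).
Proof.
by apply: measurable_funTS; apply: continuous_measurable_fun; exact: expsum_continuous.
Qed.

Lemma unit_dist_integrable f g : measurable_fun (D : set RM) f ->
  measurable_fun (D : set RM) g -> unit_on f -> unit_on g ->
  mu.-integrable D (EFin \o (fun y => `|f y - g y|)).
Proof.
move=> mf mg f1 g1; apply: (@integrable_norm_le _ _ _ _ _ _ 1) => //.
  by apply: measurableT_comp => //; exact: measurable_funB.
move=> y; rewrite /= in_itv /= andbT => y0.
have /andP[? ?] := f1 y y0; have /andP[? ?] := g1 y y0.
by rewrite ger0_norm // ler_norml; apply/andP; split; lra.
Qed.

Let dist_integrable f s : measurable_fun (D : set RM) f -> unit_on f ->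
  unit_on (expsum s) -> mu.-integrable D (EFin \o (fun y => `|f y - expsum s y|)).
Proof.
by move=> mf f1 s1; apply: unit_dist_integrable => //; exact: expsum_measurable.
Qed.

Lemma expsum_approx_eq f g : (forall y, 0 <= y -> f y = g y) ->
  expsum_approx f -> expsum_approx g.
Proof.
have D0 y : (y \in D) -> 0 <= y by rewrite inE /= in_itv /= andbT.
move=> fg [mf f1 fe]; split.
- by apply: eq_measurable_fun mf => y /D0; exact: fg.
- by move=> y y0; rewrite -fg //; exact: f1.
- move=> e /fe[s [s0 s1 se]]; exists s; split => //; apply: le_trans se.
  rewrite le_eqVlt; apply/orP; left; apply/eqP.
  by apply: eq_Rintegral => y /D0 y0; rewrite fg.
Qed.

Lemma expsum_approx_expsum s : nneg_rates s -> unit_on (expsum s) ->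
  expsum_approx (expsum s).
Proof.
move=> s0 s1; split => //; first exact: expsum_measurable.
move=> e e0; exists s; split => //.
under eq_Rintegral do rewrite subrr normr0.
by rewrite /Rintegral integral0 /= ltW.
Qed.

Lemma expsum_approx_oneB f : expsum_approx f -> expsum_approx (fun y => 1 - f y).
Proof.
move=> [mf f1 fe]; split.
- exact: measurable_funB.
- by move=> y /f1 /andP[? ?]; apply/andP; split; lra.
- move=> e /fe[s [s0 s1 se]].
  have E y : expsum ((1, 0) :: expsum_weight (fun=> -1) s) y = 1 - expsum s y.
    rewrite expsum_cons expsum_scale /= mul0r oppr0 expR0; ring.
  exists ((1, 0) :: expsum_weight (fun=> -1) s); split.
  + by rewrite /= lexx nneg_rates_weight.
  + by move=> y /s1 /andP[? ?]; rewrite E; apply/andP; split; lra.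
  + apply: le_trans se; rewrite le_eqVlt; apply/orP; left; apply/eqP.
    apply: eq_Rintegral => y _; rewrite E distrC; congr `|_|; ring.
Qed.

(** Operations that preserve [0, 1] and are 1-Lipschitz there in each argument do not leave the
    closure; products and half-sums are the instances. *)
Let approx2 (op : R -> R -> R) f g :
  (forall x y : R, 0 <= x <= 1 -> 0 <= y <= 1 -> 0 <= op x y <= 1) ->
  (forall x y x' y' : R, 0 <= x <= 1 -> 0 <= y <= 1 -> 0 <= x' <= 1 -> 0 <= y' <= 1 ->
    `|op x y - op x' y'| <= `|x - x'| + `|y - y'|) ->
  measurable_fun (D : set RM) (fun y => op (f y) (g y)) ->
  (forall s r, nneg_rates s -> nneg_rates r -> exists2 q, nneg_rates q &
     forall y, expsum q y = op (expsum s y) (expsum r y)) ->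
  expsum_approx f -> expsum_approx g -> expsum_approx (fun y => op (f y) (g y)).
Proof.
move=> op1 opB mop opq [mf f1 fe] [mg g1 ge]; split => //.
  by move=> y y0; apply: op1; [exact: f1|exact: g1].
move=> e e0; have e20 : 0 < e / 2 by lra.
have [s [s0 s1 se]] := fe _ e20; have [r [r0 r1 re]] := ge _ e20.
have [q q0 qE] := opq s r s0 r0.
have q1 : unit_on (expsum q).
  by move=> y y0; rewrite qE; apply: op1; [exact: s1|exact: r1].
exists q; split => //.
have fi := dist_integrable mf f1 s1; have gi := dist_integrable mg g1 r1.
have -> : e = e / 2 + e / 2 by lra.
apply: le_trans (lerD se re); rewrite -RintegralD //; apply: le_Rintegral => //.
- by apply: dist_integrable => // y y0; apply: op1; [exact: f1|exact: g1].
- exact: (integrableD _ fi gi).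
- move=> y; rewrite /= in_itv /= andbT => y0; rewrite qE.
  by apply: opB; [exact: f1|exact: g1|exact: s1|exact: r1].
Qed.

Lemma expsum_approxM f g : expsum_approx f -> expsum_approx g ->
  expsum_approx (fun y => f y * g y).
Proof.
move=> af ag; have [mf _ _] := af; have [mg _ _] := ag.
apply: approx2 af ag => [x y /andP[x0 x1] /andP[y0 y1]| | |s r s0 r0].
- by rewrite mulr_ge0 //= mulr_ile1.
- move=> x y x' y' /andP[? ?] /andP[? ?] /andP[? ?] /andP[? ?].
  have -> : x * y - x' * y' = (x - x') * y + x' * (y - y') by ring.
  rewrite (le_trans (ler_normD _ _)) // !normrM lerD //.
    by rewrite ler_piMr // ger0_norm.
  by rewrite ler_piMl // ger0_norm.
- exact: measurable_funM.
- exists [seq (p.1 * q.1, p.2 + q.2) | p <- s, q <- r].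
    apply/allP => _ /allpairsP[[p q] [ps qr ->]] /=.
    by apply: addr_ge0; [exact: (allP s0 _ ps)|exact: (allP r0 _ qr)].
  move=> y; rewrite /expsum big_allpairs_dep mulr_suml; apply: eq_bigr => p _.
  rewrite mulr_sumr; apply: eq_bigr => q _ /=.
  by rewrite mulrDl opprD expRD; ring.
Qed.

Lemma expsum_approx_half f g : expsum_approx f -> expsum_approx g ->
  expsum_approx (fun y => (f y + g y) / 2).
Proof.
move=> af ag; have [mf _ _] := af; have [mg _ _] := ag.
apply: (approx2 (op := fun x y => (x + y) / 2)) af ag => [x y| | |s r s0 r0].
- by move=> /andP[? ?] /andP[? ?]; apply/andP; split; lra.
- move=> x y x' y' _ _ _ _.
  have -> : (x + y) / 2 - (x' + y') / 2 = 2^-1 * (x - x') + 2^-1 * (y - y') by field.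
  rewrite (le_trans (ler_normD _ _)) // !normrM (@ger0_norm _ 2^-1) // lerD //.
    by rewrite ler_piMl //; lra.
  by rewrite ler_piMl //; lra.
- by apply: measurable_funM => //; exact: measurable_funD.
- exists (expsum_weight (fun=> 2^-1) (s ++ r)).
    by rewrite nneg_rates_weight /nneg_rates all_cat; apply/andP.
  by move=> y; rewrite expsum_scale /expsum big_cat mulrC.
Qed.

Lemma expsum_approxX f n : expsum_approx f -> expsum_approx (fun y => f y ^+ n).
Proof.
move=> af; elim: n => [|n IH].
  apply: expsum_approx_eq (@expsum_approx_expsum [:: (1, 0)] _ _) => [y _||y _].
  - by rewrite /expsum big_seq1 mul0r oppr0 expR0 mulr1 expr0.
  - by rewrite /= lexx.
  - by rewrite /expsum big_seq1 mul0r oppr0 expR0 mulr1 ler01 lexx.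
by under eq_fun do rewrite exprS; exact: expsum_approxM.
Qed.

(** Dominated convergence, with the constant 1 integrable because [mu] is finite on the
    half-line. *)
Lemma expsum_approx_lim (f : nat -> R -> R) g : (forall n, expsum_approx (f n)) ->
  (forall y, 0 <= y -> f n y @[n --> \oo] --> g y) -> expsum_approx g.
Proof.
move=> af fg.
have mf n : measurable_fun (D : set RM) (f n) by case: (af n).
have f1 n : unit_on (f n) by case: (af n).
have D0 (y : R) : D y -> 0 <= y by rewrite /= in_itv /= andbT.
have mg : measurable_fun (D : set RM) g.
  by apply: (measurable_fun_cvg mf) => y /D0; exact: fg.
have g1 : unit_on g.
  move=> y y0; apply/andP; split.
    apply: (cvgr_to_ge (fg y y0)); near=> n; by have /andP[] := f1 n y y0.
  apply: (cvgr_to_le (fg y y0)); near=> n; by have /andP[] := f1 n y y0.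
split => // e e0; have e20 : 0 < e / 2 by lra.
have [] := @dominated_convergence _ RM R mu D _ (fun n => EFin \o f n) (EFin \o g) (EFin \o cst 1).
- by [].
- by move=> n; apply/measurable_EFinP.
- exact/measurable_EFinP.
- by apply: aeW => y /D0 y0; apply: cvg_EFin; [exact: nearW|exact: fg].
- apply: (@integrable_norm_le _ _ _ _ _ _ 1) => // y _.
  by rewrite /= normr1.
- apply: aeW => y n /D0 y0 /=; rewrite lee_fin.
  by have /andP[? ?] := f1 n y y0; rewrite ger0_norm.
move=> _ lim0 _.
have dE n : (\int[mu]_(y in D) `|(EFin \o f n) y - (EFin \o g) y|)%E =
    (\int[mu]_(y in D) `|f n y - g y|)%:E.
  rewrite /Rintegral fineK //; apply: integrable_fin_num => //.
  exact: unit_dist_integrable.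
have [n ne] : exists n, \int[mu]_(y in D) `|f n y - g y| <= e / 2.
  have /fine_cvgP[_ /cvgrPdist_le/(_ _ e20)[n _ /(_ n (leqnn n))]] := lim0.
  rewrite /= sub0r normrN; set I := fine _ => Ie; exists n.
  suff <- : I = \int[mu]_(y in D) `|f n y - g y| by exact: le_trans (ler_norm _) Ie.
  by rewrite /I dE.
have [_ _ /(_ _ e20)[s [s0 s1 se]]] := af n.
exists s; split => //.
have fi := dist_integrable (mf n) (f1 n) s1.
have gi := unit_dist_integrable (mf n) mg (f1 n) g1.
have -> : e = e / 2 + e / 2 by lra.
apply: le_trans (lerD ne se); rewrite -RintegralD //; apply: le_Rintegral => //.
- exact: dist_integrable.
- exact: (integrableD _ gi fi).
- by move=> y _; rewrite (distrC (f n y)) (le_trans _ (ler_normD _ _)) // addrA subrK.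
Unshelve. all: by end_near. Qed.

(* For k = ln 2 / a, (1 - e^{-n k y})^(n 2^n) tends to 1 if y > a and to 0 if
   y <= a; the factor n in the exponent takes care of y = a. *)
Lemma expsum_approx_itvoy (a : R) : 0 < a -> expsum_approx \1_(`]a, +oo[).
Proof.
move=> a0; pose k := ln 2 / a.
have ln20 : 0 < ln (2 : R) by rewrite ln_gt0 // ltr1n.
have k0 : 0 < k by rewrite divr_gt0.
pose f n y := (1 - expR (- (n%:R * k * y))) ^+ (n * 2 ^ n).
have af n : expsum_approx (f n).
  apply/expsum_approxX/expsum_approx_oneB.
  apply: expsum_approx_eq (@expsum_approx_expsum [:: (1, n%:R * k)] _ _) => [y _||y y0].
  - by rewrite /expsum big_seq1 mul1r.
  - by rewrite /= mulr_ge0 // ltW.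
  - rewrite /expsum big_seq1 mul1r; apply: expRN_itv.
    by rewrite mulr_ge0 // mulr_ge0 // ltW.
apply: (expsum_approx_lim af) => y y0.
pose z := k * y - ln 2.
have pow n : (n * 2 ^ n)%:R * expR (- (n%:R * k * y)) = n%:R * expR (- (n%:R * z)).
  rewrite natrM natrX -[2 in LHS](@lnK R) ?posrE // -expRM_natl -mulrA -expRD.
  by congr (_ * expR _); rewrite /z; ring.
have f01 n : 0 <= 1 - expR (- (n%:R * k * y)) <= 1.
  have /andP[? ?] : 0 <= expR (- (n%:R * k * y)) <= 1.
    by apply: expRN_itv; rewrite mulr_ge0 // mulr_ge0 // ltW.
  by apply/andP; split; lra.
have az : (a < y) = (0 < z) by rewrite subr_gt0 /k mulrAC ltr_pdivlMr // ltr_pM2l.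
rewrite indicE mem_setE in_itv /= andbT az; case: ltP => z0 /=.
(* Bernoulli's inequality (1 - w)^N >= 1 - N w, where N w = n e^{-nz} and e^{nz} >= (nz)^2 / 2. *)
- have lb n : 1 - 2 / z ^+ 2 * n%:R^-1 <= f n y <= 1.
    have /andP[g0 g1] := f01 n.
    have -> /= : f n y <= 1 by exact: exprn_ile1.
    rewrite andbT; case: n g0 g1 => [|n] g0 g1.
      by rewrite invr0 mulr0 subr0 /f mul0n expr0.
    have : 1 - (n.+1 * 2 ^ n.+1)%:R * expR (- (n.+1%:R * k * y)) <= f n.+1 y.
      rewrite /f; move: (n.+1 * 2 ^ n.+1)%N (expR _) g0 => N w g0 {g1}.
      have w1 : w <= 1 by lra.
      elim: N => [|N IH]; first by rewrite mul0r subr0 expr0.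
      have ww : (1 - w) * (1 - N%:R * w) <= (1 - w) ^+ N.+1 by rewrite exprS ler_wpM2l.
      apply: le_trans ww; rewrite -natr1; have : 0 <= N%:R :> R by [].
      have : 0 <= w ^+ 2 by exact: sqr_ge0.
      move=> h1 h2; have := mulr_ge0 h2 h1; lra.
    apply: le_trans; rewrite lerD2l lerN2 pow.
    have nz0 : 0 < n.+1%:R * z by rewrite mulr_gt0.
    have := expR_ge1Dxn 1 (ltW nz0).
    rewrite expRN => h.
    apply: (@le_trans _ _ (n.+1%:R / ((n.+1%:R * z) ^+ 2 / 2))).
      rewrite ler_pM2l // lef_pV2 ?posrE ?expR_gt0 ?divr_gt0 ?exprn_gt0 //.
      by apply: le_trans h; rewrite ler_wpDl.
    rewrite le_eqVlt; apply/orP; left; apply/eqP; field.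
    by rewrite !gt_eqF.
  apply: (@squeeze_cvgr _ _ _ _ (fun n : nat => 1 - 2 / z ^+ 2 * n%:R^-1) (cst 1)).
  + by near=> n; exact: lb.
  + rewrite -[X in _ --> X]subr0; apply: cvgB; first exact: cvg_cst.
    rewrite -[X in _ --> X](mulr0 (2 / z ^+ 2)); apply: cvgMr.
    apply/gtr0_cvgV0; last exact: cvgr_idn.
    by near=> n; rewrite ltr0n; near: n; exists 1%N.
  + exact: cvg_cst.
(* Here (1 - w)^N <= e^{-N w}, and N w = n e^{-nz} >= n because z <= 0. *)
- have ub n : 0 <= f n y <= expR (- n%:R).
    have /andP[g0 g1] := f01 n; rewrite exprn_ge0 //=.
    apply: (@le_trans _ _ (expR (- expR (- (n%:R * k * y))) ^+ (n * 2 ^ n))).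
      by rewrite lerXn2r // ?nnegrE ?expR_ge0 // expRN_ge1B.
    rewrite -expRM_natl ler_expR mulrN lerN2 pow ler_peMr //.
    by rewrite -expR0 ler_expR oppr_ge0 mulr_ge0_le0.
  apply: (@squeeze_cvgr _ _ _ _ (cst 0) (fun n : nat => expR (- n%:R))).
  + by near=> n; exact: ub.
  + exact: cvg_cst.
  + exact: cvgn_expR.
Unshelve. all: by end_near. Qed.

(** The indicator of the union is the limit of 1 - prod_{k < n} (1 - 1_{F_k}), built from
    complements, products and a limit only. *)
Lemma expsum_approx_bigcup (F : nat -> set R) :
  (forall n, expsum_approx \1_(F n)) -> expsum_approx \1_(\bigcup_n F n).
Proof.
move=> aF; pose f n y := 1 - \prod_(k < n) (1 - \1_(F k) y) : R.
have af n : expsum_approx (f n).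
  apply: expsum_approx_oneB; elim: n => [|n IH].
    apply: expsum_approx_eq (expsum_approxX 0 (aF 0%N)) => y _.
    by rewrite big_ord0 expr0.
  apply: (@expsum_approx_eq (fun y => \prod_(k < n) (1 - \1_(F k) y) * (1 - \1_(F n) y))).
    by move=> y _; rewrite big_ord_recr.
  by apply: expsum_approxM => //; exact: expsum_approx_oneB.
apply: (expsum_approx_lim af) => y y0; rewrite indicE.
have [[k _ Fky]|nF] := pselect ((\bigcup_n F n) y).
  rewrite mem_set; last by exists k.
  apply: cvg_near_cst; near=> n.
  have kn : (k < n)%N by near: n; exists k.+1.
  rewrite /f (bigD1 (Ordinal kn)) //= indicE mem_set // subrr mul0r subr0 //.
rewrite memNset //; apply: cvg_near_cst; near=> n.
rewrite /f big1 ?subrr // => k _; rewrite indicE memNset ?subr0 // => Fky.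
by apply: nF; exists k.
Unshelve. all: by end_near. Qed.

(** The sets with approximable indicator form a sigma-algebra containing the rays ]a, oo[, which
    generate the Borel sets. The ray from 0 is a union of rays from 1 / (n+1); for a < 0 the
    indicator is 1 on the half-line. *)
Lemma expsum_approx_indic A : measurable A -> expsum_approx \1_A.
Proof.
move=> mA; have {}mA : <<s RGenOInfty.G (R := R) >> A.
  by have := mA; rewrite -[_.-measurable]/(_.-sigma.-measurable) RGenOInfty.measurableE.
have one : expsum_approx (cst 1).
  by apply: expsum_approx_eq (expsum_approxX 0 (expsum_approx_itvoy ltr01)).
pose S := [set B : set R | expsum_approx \1_B].
suff SA : sigma_algebra setT S.
  apply: (smallest_sub SA _ mA) => _ [a ->]; rewrite /S /=.
  have [a0|a0|->] := ltgtP a 0; last first.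
  - have -> : `]0, +oo[%classic = \bigcup_n `]n.+1%:R^-1, +oo[%classic :> set R.
      apply/seteqP; split => y /=; rewrite in_itv /= andbT => y0.
        have [n yn] := ltr_add_invr y0; exists n => //=.
        by rewrite in_itv /= andbT; rewrite add0r in yn.
      case: y0 => n _; rewrite /= in_itv /= andbT; apply: lt_trans.
      by rewrite invr_gt0.
    by apply: expsum_approx_bigcup => n; apply: expsum_approx_itvoy; rewrite invr_gt0.
  - exact: expsum_approx_itvoy.
  - apply: expsum_approx_eq one => y y0.
    by rewrite indicE mem_set // /= in_itv /= andbT (lt_le_trans a0).
split.
- apply: expsum_approx_eq (expsum_approx_oneB one) => y _.
  by rewrite indic0 subrr.
- move=> B SB; apply: expsum_approx_eq (expsum_approx_oneB SB) => y _.
  by rewrite setTD !indicE in_setC; case: (y \in B); rewrite ?subrr ?subr0.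
- by move=> F SF; exact: expsum_approx_bigcup.
Qed.

(** Iterating the binary splitting writes f, up to 2^-n, as nested half-sums of indicators. *)
Lemma expsum_approx_measurable f :
  measurable_fun (D : set RM) f -> unit_on f -> expsum_approx f.
Proof.
move=> mf f1.
have dyadic n : forall g, measurable_fun (D : set RM) g -> unit_on g ->
    exists2 h, expsum_approx h & forall y : R, 0 <= y -> `|g y - h y| <= 2^-1 ^+ n.
  elim: n => [|n IH] g mg g1.
    exists (expsum [::]).
      by apply: expsum_approx_expsum => // y _; rewrite /expsum big_nil lexx ler01.
    move=> y /g1 /andP[? ?].
    by rewrite /expsum big_nil subr0 expr0 ger0_norm.
  have [B [g' [mB _ mg' g'1 gE]]] := dyadic_split mg g1.
  have [h ah hg] := IH _ mg' g'1; exists (fun y => (\1_B y + h y) / 2).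
    by apply: expsum_approx_half => //; exact: expsum_approx_indic.
  move=> y y0; rewrite gE //.
  have -> : (\1_B y + g' y) / 2 - (\1_B y + h y) / 2 = 2^-1 * (g' y - h y) by field.
  by rewrite normrM ger0_norm // exprS ler_wpM2l // hg.
have /choice[h hP] : forall n, exists h, expsum_approx h /\
    forall y : R, 0 <= y -> `|f y - h y| <= 2^-1 ^+ n.
  by move=> n; have [h ah hf] := dyadic n f mf f1; exists h.
apply: (@expsum_approx_lim h) => [n|y y0]; first by case: (hP n).
apply/cvgrPdist_le => e e0; near=> n.
have [_ /(_ y y0)/le_trans] := hP n; apply.
have : `|0 - 2^-1 ^+ n| <= e.
  near: n; move: e e0; apply/cvgrPdist_le; apply: cvg_expr.
  by rewrite ger0_norm //; lra.
by rewrite sub0r normrN; apply: le_trans; exact: ler_norm.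
Unshelve. all: by end_near. Qed.

End expsum_density.

(** Approximating f in L^1 of mu1 + mu2 controls both integrals with one sum; the error tends to 0,
    so K is kept. *)
Lemma measure_dist_expsum (R : realType)
    (mu1 mu2 : {measure set (measurableTypeR R) -> \bar R}) (K : R) (f : R -> R) :
  let D := `[0, +oo[%classic : set R in
  (mu1 D < +oo)%E -> (mu2 D < +oo)%E ->
  (forall s, nneg_rates s -> (forall y : R, 0 <= y -> 0 <= expsum s y <= 1) ->
    `|\int[mu1]_(y in D) expsum s y - \int[mu2]_(y in D) expsum s y| <= K) ->
  measurable_fun (D : set (measurableTypeR R)) f ->
  (forall y : R, 0 <= y -> 0 <= f y <= 1) ->
  `|\int[mu1]_(y in D) f y - \int[mu2]_(y in D) f y| <= K.
Proof.
move=> D fin1 fin2 muK mf f1.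
have mD : measurable (D : set (measurableTypeR R)) by exact: measurable_itv.
pose mu : {measure set (measurableTypeR R) -> \bar R} := measure_add mu1 mu2.
have muD : (mu D < +oo)%E 
  by rewrite (_ : mu D = (mu1 D + mu2 D)%E); [exact: lte_add_pinfty|exact: measure_addE].
have [_ _ fe] := expsum_approx_measurable muD mf f1.
apply/ler_addgt0Pr => e e0.
have [s [s0 s1 se]] := fe _ e0.
have ms := @expsum_measurable R s D.
pose d y : R := `|f y - expsum s y|.
have di1 := unit_dist_integrable fin1 mf ms f1 s1.
have di2 := unit_dist_integrable fin2 mf ms f1 s1.
have muadd : \int[mu]_(y in D) d y = \int[mu1]_(y in D) d y + \int[mu2]_(y in D) d y.
  rewrite /Rintegral ge0_integral_measure_add //.
  + by rewrite fineD //; [exact: integrable_fin_num di1|exact: integrable_fin_num di2].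
  + by move=> y _; rewrite lee_fin /d.
  + apply/measurable_EFinP; apply: measurableT_comp => //; exact: measurable_funB.
have dist (nu : {measure set (measurableTypeR R) -> \bar R}) : (nu D < +oo)%E ->
    `|\int[nu]_(y in D) f y - \int[nu]_(y in D) expsum s y| <= \int[nu]_(y in D) d y.
  move=> nuD.
  have fi := unit_integrable nuD mf f1; have si := unit_integrable nuD ms s1.
  rewrite -RintegralB //; apply: le_normr_Rintegral => //.
  exact: (integrableB _ fi si).
have := dist _ fin1; have := dist _ fin2; have := muK s s0 s1.
have := se; rewrite -[X in X <= e]/(\int[mu]_(y in D) d y) muadd.
move: (\int[mu1]_(y in D) d y) (\int[mu2]_(y in D) d y) => d1 d2.
rewrite !ler_norml.
move: (\int[mu1]_(y in D) f y) (\int[mu2]_(y in D) f y)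
  (\int[mu1]_(y in D) expsum s y) (\int[mu2]_(y in D) expsum s y).
by move=> a1 a2 b1 b2 ? /andP[? ?] /andP[? ?] /andP[? ?]; apply/andP; split; lra.
Qed.

(** * Ergodicity *)

Section setwise_limit.
Context d (T : measurableType d) (R : realType).
Context (p : nat -> {measure set T -> \bar R}) (eps : nat -> R).
Context (p1 : forall n, p n setT = 1%E) (eps0 : eps n @[n --> \oo] --> 0).
Context (p_cauchy : forall n k A, measurable A -> (n <= k)%N ->
  `|fine (p n A) - fine (p k A)| <= eps n).
Implicit Types A B : set T.

Let q n A := fine (p n A).

Let p_fin n A : measurable A -> p n A \is a fin_num.
Proof.
move=> mA; rewrite ge0_fin_numE //; apply: (@le_lt_trans _ _ (p n setT)).
  by apply: le_measure; rewrite ?inE.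
by rewrite p1 ltry.
Qed.

Let q_cvg A : measurable A -> cvgn (q ^~ A).
Proof.
move=> mA; apply/cauchy_cvgP; apply: cauchy_exP => e e0.
have e20 : 0 < e / 2 by rewrite divr_gt0.
have /cvgrPdist_le/(_ _ e20)[n _ /(_ n (leqnn n))] := eps0.
rewrite /= sub0r normrN => epsn.
exists (q n A); near=> k; rewrite /ball /= /ball_ /=.
have nk : (n <= k)%N by near: k; exists n.
apply: le_lt_trans (p_cauchy mA nk) _; apply: le_lt_trans (ler_norm _) _.
by apply: le_lt_trans epsn _; lra.
Unshelve. all: by end_near. Qed.

(* The maximum only matters for nonmeasurable sets, where the limit is junk. *)
Let eta A := (Num.max 0 (limn (q ^~ A)))%:E.

Let etaE A : measurable A -> eta A = (limn (q ^~ A))%:E.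
Proof.
move=> mA; congr EFin; apply: max_idPr; apply: (cvgr_to_ge (q_cvg mA)).
by near=> n; rewrite /q fine_ge0.
Unshelve. all: by end_near. Qed.

Let q_eta n A : measurable A -> `|q n A - limn (q ^~ A)| <= eps n.
Proof.
move=> mA.
have c : `|q n A - q k A| @[k --> \oo] --> `|q n A - limn (q ^~ A)|.
  by apply: cvg_norm; apply: cvgB; [exact: cvg_cst|exact: q_cvg].
apply: (cvgr_to_le c); near=> k; apply: p_cauchy => //.
by near: k; exists n.
Unshelve. all: by end_near. Qed.

Let eta0 : eta set0 = 0%E.
Proof.
rewrite etaE //; congr EFin; apply/cvg_lim => //.
by under eq_cvg do rewrite /q measure0 /=; exact: cvg_cst.
Qed.

Let eta_ge0 A : (0 <= eta A)%E.
Proof. by rewrite lee_fin le_max lexx. Qed.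

(** Uniformity over sets allows one index n for the union U and all its partial unions U_k: the
    error for eta is at most 2 eps_n plus |p_n U - p_n U_k|, which vanishes as k grows. *)
Let eta_sigma_additive : semi_sigma_additive eta.
Proof.
move=> F mF tF mU; rewrite etaE //.
pose U := \bigcup_n F n; pose Uk k := \big[setU/set0]_(i < k) F i.
have mUk k : measurable (Uk k) by apply: bigsetU_measurable.
have sumE k : (\sum_(0 <= i < k) eta (F i))%E = (limn (q ^~ (Uk k)))%:E.
  rewrite (eq_bigr (fun i => (limn (q ^~ (F i)))%:E)) => [|i _]; last exact: etaE.
  rewrite sumEFin; congr EFin; apply/esym/cvg_lim => //.
  have -> : q ^~ (Uk k) = fun n => \sum_(0 <= i < k) q n (F i).
    apply/funext => n; rewrite /q /Uk measure_bigsetU //.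
    by rewrite big_mkord sum_fine // => i _; exact: p_fin.
  by apply: cvg_bigsum => i _; exact: q_cvg.
under eq_cvg do rewrite sumE.
apply: cvg_EFin; first exact: nearW.
apply/cvgrPdist_le => e e0; have e30 : 0 < e / 3 by rewrite divr_gt0.
have /cvgrPdist_le/(_ _ e30)[n _ /(_ n (leqnn n))] := eps0.
rewrite /= sub0r normrN => epsn.
have en : eps n <= e / 3 by apply: le_trans epsn; exact: ler_norm.
have qU : q n (Uk k) @[k --> \oo] --> q n U.
  have pU := @measure_semi_sigma_additive _ _ _ (p n) F mF tF mU.
  have : (p n (Uk k)) @[k --> \oo] --> p n U.
    apply: cvg_trans pU; apply: near_eq_cvg; near=> k.
    by rewrite /Uk measure_bigsetU // big_mkord.
  by rewrite -(fineK (p_fin n mU)) => /fine_cvgP[].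
near=> k.
have : `|q n U - q n (Uk k)| <= e / 3.
  by near: k; move/cvgrPdist_le : qU; exact.
have := q_eta n (mUk k); have := q_eta n mU.
rewrite !ler_norml => /andP[? ?] /andP[? ?] /andP[? ?].
by apply/andP; split; lra.
Unshelve. all: by end_near. Qed.

HB.instance Definition _ := isMeasure.Build _ _ _ eta eta0 eta_ge0 eta_sigma_additive.

Let eta_setT : eta setT = 1%E.
Proof.
rewrite etaE //; congr EFin; apply/cvg_lim => //.
by under eq_cvg do rewrite /q p1 /=; exact: cvg_cst.
Qed.

HB.instance Definition _ := Measure_isProbability.Build _ _ _ eta eta_setT.

Lemma setwise_limit_probability : exists mu : probability T R,
  forall n A, measurable A -> `|fine (p n A) - fine (mu A)| <= eps n.
Proof.
exists eta => n A mA; rewrite -[fine (p n A)]/(q n A) -[X in fine X]/(eta A).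
by rewrite etaE //; exact: q_eta.
Qed.

End setwise_limit.

(** * Convergence of the CBI laws and the Laplace transform of the limit *)

Section ergodicity.
Context {R : realType}.
Local Notation RM := (measurableTypeR R).
Local Notation leb := (@lebesgue_measure R).
Local Notation D := (`[0, +oo[%classic : set R).
Context (b c beta : R) (m nu : {measure set RM -> \bar R}).
Context (v : R -> R -> R) (P : R -> R.-pker RM ~> RM).
Local Notation phi := (branching_mechanism b c m).
Local Notation psi := (immigration_mechanism beta nu).
Context (b_gt0 : 0 < b) (c_ge0 : 0 <= c) (bm : branching_measure m).
Context (beta_ge0 : 0 <= beta).
Context (nu_mean : (\int[nu]_(u in `]0%R, +oo[) u%:E < +oo)%E).
Context (cv : cumulant_semigroup phi v) (cbi : CBI_semigroup psi v P).
Implicit Types (A : set RM) (x y z s t r h lam V : R).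

Let phi0 : phi 0 = 0 := branching_mechanism0 b c m.
Let phi_lb y z := @branching_mechanism_lb R b c m y z bm c_ge0.
Let phi_ub y z Z := @branching_mechanism_ub R b c m y z Z bm c_ge0.

Let C := b^-1 * immigration_mean beta nu.

Lemma immigration_mechanism_le z : 0 <= z ->
  0 <= psi z <= immigration_mean beta nu * z.
Proof.
move=> z0; have := immigration_mechanism_itv beta_ge0 nu_mean (lexx 0) z0.
by rewrite immigration_mechanism0 !subr0.
Qed.

Lemma immigration_mean_ge0 : 0 <= immigration_mean beta nu.
Proof.
by have /andP[h1 h2] := immigration_mechanism_le ler01; move: (le_trans h1 h2); rewrite mulr1.
Qed.

Let C_ge0 : 0 <= C.
Proof. by rewrite mulr_ge0 ?immigration_mean_ge0 // invr_ge0 ltW. Qed.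

Let psi_cont : continuous (fun z : R => psi (Num.max z 0)).
Proof.
apply: (@lipschitz_clamp_continuous _ _ (immigration_mean beta nu)) => x y x0 xy.
have /andP[h1 h2] := immigration_mechanism_itv beta_ge0 nu_mean x0 xy.
by rewrite distrC ger0_norm.
Qed.

Let psi_path_itv t lam : 0 <= lam -> 0 <= t -> 0 <= psi (v t lam) <= C * phi (v t lam).
Proof.
move=> l0 t0; have v0 := cumulant_ge0 cv l0 t0.
have /andP[-> h] := immigration_mechanism_le v0.
apply: (le_trans h); rewrite /C -mulrA mulrCA ler_wpM2l ?immigration_mean_ge0 //.
by rewrite mulrC ler_pdivlMr // mulrC; exact: mechanism_ge.
Qed.

Let psi_path_integrable t lam : 0 <= lam -> 0 <= t ->
  leb.-integrable `[0, t] (EFin \o (fun s => psi (v s lam))).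
Proof.
move=> l0 t0; have [_ vi _] := cv l0 t0.
apply: (le_integrable _ _ _ (integrableZl _ C vi)) => //.
  apply: (cumulant_path_measurable b_gt0 phi0 phi_lb cv psi_cont l0) => s /=.
  by rewrite !in_itv /= andbT => /andP[].
move=> s; rewrite /= in_itv /= => /andP[s0 _].
have /andP[h1 h2] := psi_path_itv l0 s0.
by rewrite lee_fin !ger0_norm // (le_trans h1).
Qed.

Let J t lam := \int[leb]_(s in `[0, t]) psi (v s lam).

(* As b z <= phi z, the integral of psi(v_s) is at most C times that of phi(v_s),
   which is lam - v_t(lam). *)
Let J_itv t lam : 0 <= lam -> 0 <= t -> 0 <= J t lam <= C * lam.
Proof.
move=> l0 t0; apply/andP; split.
  apply: Rintegral_ge0 => s; rewrite /= in_itv /= => /andP[s0 _].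
  by have /andP[] := psi_path_itv l0 s0.
have [v0 vi vE] := cv l0 t0.
apply: (@le_trans _ _ (\int[leb]_(s in `[0, t]) (C * phi (v s lam)))).
  apply: le_Rintegral => //; first exact: psi_path_integrable.
    by have := integrableZl _ C vi; exact.
  move=> s; rewrite /= in_itv /= => /andP[s0 _].
  by have /andP[] := psi_path_itv l0 s0.
by rewrite RintegralZl // ler_wpM2l //; lra.
Qed.

Let P_laplace0 t lam : 0 <= t -> 0 <= lam ->
  laplace (P t 0) lam = (expR (- J t lam))%:E.
Proof.
by move=> t0 l0; case: cbi => _ ->//; rewrite mul0r oppr0 add0r.
Qed.

Let P_D t x : 0 <= t -> 0 <= x -> P t x D = 1%E.
Proof. by move=> t0 x0; case: cbi => [[+ _] _]; exact. Qed.

Let P_fin t x A : measurable A -> P t x A \is a fin_num.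
Proof.
move=> mA; rewrite ge0_fin_numE //; apply: (@le_lt_trans _ _ (P t x setT)).
  by apply: le_measure; rewrite ?inE.
by rewrite prob_kernel ltry.
Qed.

Let P_setID t x A : 0 <= t -> 0 <= x -> measurable A -> P t x (A `&` D) = P t x A.
Proof.
move=> t0 x0 mA; have mD : measurable (D : set RM) by [].
have DC : P t x (~` D) = 0%E.
  have : (P t x setT = P t x D + P t x (~` D))%E.
    by rewrite -measureU ?setUv ?setICr //; exact: measurableC.
  rewrite P_D // [P t x setT](prob_kernel (s := P t)).
  have : (P t x (~` D)) \is a fin_num by apply: P_fin; exact: measurableC.
  by case: (P t x (~` D)) => // r _; rewrite -EFinD => -[h]; congr EFin; lra.
rewrite -{2}(setUIDK A D) measureU //; last 3 first.
- exact: measurableI.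
- exact: measurableD.
- by rewrite -subset0 => y [[_ yD] [_]].
rewrite -[LHS]adde0; congr (_ + _)%E; apply/esym/eqP.
rewrite eq_le measure_ge0 andbT -DC.
have mAD : measurable (A `\` D) by exact: measurableD.
have mDC : measurable (~` D : set RM) by exact: measurableC.
by apply: le_measure; rewrite ?inE //; move=> y [].
Qed.

(* Fatou's lemma for (1 - e^{-y/n}) n, which tends to y. *)
Lemma CBI_mean_le t : 0 <= t -> (\int[P t 0%R]_(y in D) y%:E <= C%:E)%E.
Proof.
move=> t0.
pose f (n : nat) := expsum [:: (n.+1%:R, 0); (- n.+1%:R, n.+1%:R^-1 : R)].
have fE n y : f n y = n.+1%:R * (1 - expR (- (n.+1%:R^-1 * y))).
  by rewrite /f /expsum big_cons big_seq1 /= mul0r oppr0 expR0; ring.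
have f0 n y : 0 <= y -> 0 <= f n y.
  move=> y0; rewrite fE mulr_ge0 // subr_ge0.
  have y1 : 0 <= n.+1%:R^-1 * y by rewrite mulr_ge0 // invr_ge0.
  by have /andP[] := expRN_itv y1.
have f_rates n : nneg_rates [:: (n.+1%:R, 0); (- n.+1%:R, n.+1%:R^-1 : R)].
  by rewrite /= lexx invr_ge0 ler0n.
have f_cvg y : 0 <= y -> (f n y)%:E @[n --> \oo] --> y%:E.
  move=> y0; apply: cvg_EFin; first exact: nearW.
  apply: (@squeeze_cvgr _ _ _ _ (fun n : nat => y * expR (- (n.+1%:R^-1 * y))) (cst y)).
  - near=> n; rewrite /= fE.
    have := oneB_expRN_ge (n.+1%:R^-1 * y); have := expRN_ge1B (n.+1%:R^-1 * y).
    move: (expR _) => E h1 h2.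
    have n0 : 0 < n.+1%:R :> R by [].
    have nn : n.+1%:R * n.+1%:R^-1 = 1 :> R by rewrite divff // gt_eqF.
    apply/andP; split.
      have -> : y * E = n.+1%:R * (n.+1%:R^-1 * y * E) by rewrite !mulrA nn mul1r.
      by rewrite ler_pM2l.
    rewrite [leRHS](_ : _ = n.+1%:R * (n.+1%:R^-1 * y)); last by rewrite mulrA nn mul1r.
    by rewrite ler_pM2l // lerBlDr addrC -lerBlDr.
  - rewrite -[X in _ --> X]mulr1; apply: cvgMr.
    rewrite -[X in _ --> X]expR0; apply: continuous_cvg; first exact: continuous_expR.
    rewrite -[X in _ --> X]oppr0; apply: cvgN.
    rewrite -[X in _ --> X](mul0r y); apply: cvgMl.
    exact: cvg_harmonic.
  - exact: cvg_cst.
have -> : (\int[P t 0%R]_(y in D) y%:E =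
    \int[P t 0%R]_(y in D) limn_einf (fun n => (f n y)%:E))%E.
  apply: eq_integral => y; rewrite inE /= in_itv /= andbT => y0.
  by rewrite (cvg_limn_einf_sup (f_cvg y y0)).
apply: (@le_trans _ _ (limn_einf (fun n => \int[P t 0%R]_(y in D) (f n y)%:E)%E)).
  apply: (fatou (P t 0) _ (f := fun n y => (f n y)%:E)) => //.
    by move=> n; apply/measurable_EFinP; exact: expsum_measurable.
  by move=> n y; rewrite /= in_itv /= andbT => y0; rewrite lee_fin f0.
(* With N = n + 1, the Laplace formula gives N (1 - e^{-J_t(1/N)}) <= N J_t(1/N) <= C. *)
have fle n : (\int[P t 0%R]_(y in D) (f n y)%:E <= C%:E)%E.
  have PL lam : 0 <= lam -> laplace (P t 0) lam = (expR (- J t lam))%:E.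
    exact: P_laplace0.
  have fi := expsum_integrable PL (f_rates n).
  rewrite -(fineK (integrable_fin_num _ fi)) // lee_fin.
  have := Rintegral_expsum PL (f_rates n).
  rewrite /Rintegral => ->; rewrite big_cons big_seq1 /=.
  have l0 : 0 <= n.+1%:R^-1 :> R by rewrite invr_ge0.
  have /andP[j0 j1] := J_itv (lexx 0) t0; have /andP[_ j2] := J_itv l0 t0.
  rewrite mulr0 in j1; have -> : J t 0 = 0 by apply/le_anti/andP; split.
  rewrite oppr0 expR0 mulr1 mulNr -[X in X - _]mulr1 -mulrBr.
  apply: (@le_trans _ _ (n.+1%:R * (C * n.+1%:R^-1))).
    by apply: ler_wpM2l; [exact: ler0n|exact: le_trans (oneB_expRN_le _) j2].
  by rewrite mulrCA divff ?mulr1 // gt_eqF.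
rewrite limn_einf_lim (cvg_lim _ (@cvg_einfs_sup _ _)) //.
apply: ge_ereal_sup => _ [n _ <-]; apply: le_trans (fle n).
by apply: ereal_inf_lbound; exists n => //=.
Unshelve. all: by end_near. Qed.

Let CBI_set_lipschitz_le t x h V A : 0 <= t -> 0 <= x -> 0 <= h ->
  (forall lam, 0 <= lam -> v t lam <= V) -> measurable A ->
  `|fine (P t (x + h) A) - fine (P t x A)| <= h * V.
Proof.
move=> t0 x0 h0 vV mA; have xh0 := addr_ge0 x0 h0.
have PE z : 0 <= z -> fine (P t z A) = \int[P t z]_(u in D) (\1_A u : R).
  by move=> z0; rewrite /Rintegral integral_indic // P_setID.
rewrite !PE //.
have D1 z : 0 <= z -> (P t z D < +oo)%E by move=> z0; rewrite [P t z _]P_D // ltry.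
apply: (measure_dist_expsum (D1 _ xh0) (D1 _ x0)).
- by move=> s s0 s1; apply: (CBI_expsum_lipschitz b_gt0 c_ge0 bm cv cbi).
- by apply: measurable_funTS; exact: measurable_indic.
- by move=> u _; rewrite indicE; case: (_ \in _); rewrite /= ?ler01 ?lexx.
Qed.

Lemma CBI_set_lipschitz t x y V A : 0 <= t -> 0 <= x -> 0 <= y ->
  (forall lam, 0 <= lam -> v t lam <= V) -> measurable A ->
  `|fine (P t x A) - fine (P t y A)| <= `|x - y| * V.
Proof.
move=> t0 x0 y0 vV mA; have [xy|/ltW yx] := leP x y.
  have h0 : 0 <= y - x by rewrite subr_ge0.
  have := CBI_set_lipschitz_le t0 x0 h0 vV mA.
  have -> : x + (y - x) = y by ring.
  by rewrite distrC (distrC x) (ger0_norm h0).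
have h0 : 0 <= x - y by rewrite subr_ge0.
have := CBI_set_lipschitz_le t0 y0 h0 vV mA.
have -> : y + (x - y) = x by ring.
by rewrite (ger0_norm h0).
Qed.

Lemma CBI_set_cauchy s t x V A : 0 <= s -> 0 <= t -> 0 <= x ->
  (forall lam, 0 <= lam -> v t lam <= V) -> measurable A ->
  `|fine (P t x A) - fine (P (s + t) 0 A)| <= (x + C) * V.
Proof.
move=> s0 t0 x0 vV mA.
have V0 : 0 <= V by apply: le_trans (vV 0 (lexx 0)); exact: (cumulant_ge0 cv).
have PsD : (P s 0%R D < +oo)%E by rewrite [P s 0%R _]P_D // ltry.
have yi : (P s 0).-integrable D (EFin \o (fun y : R => y)).
  apply/integrableP; split; first by apply/measurable_EFinP.
  under eq_integral.
    move=> y; rewrite inE /= in_itv /= andbT => y0.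
    by rewrite ger0_norm //; over.
  exact: le_lt_trans (CBI_mean_le s0) (ltry _).
have ymean : \int[P s 0]_(y in D) y <= C.
  rewrite -lee_fin /Rintegral fineK; first exact: CBI_mean_le.
  exact: integrable_fin_num yi.
have PA1 y : 0 <= fine (P t y A) <= 1.
  rewrite fine_ge0 //= -lee_fin fineK ?P_fin // -(prob_kernel (s := P t) y).
  by apply: le_measure; rewrite ?inE.
have mPA : measurable_fun (D : set RM) (fun y : R => fine (P t y A)).
  apply: measurable_funTS; apply: measurableT_comp; first exact: fine_measurable.
  exact: measurable_kernel.
have PAi : (P s 0).-integrable D (EFin \o (fun y : R => fine (P t y A))).
  by apply: unit_integrable.
have cst_int k : (P s 0).-integrable D (EFin \o (fun _ : R => k)).
  by apply: (@integrable_norm_le _ _ _ _ _ _ `|k|).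
have Rcst k : \int[P s 0]_(y in D) k = k.
  by rewrite Rintegral_cst // [P s 0 _]P_D // mulr1.
have -> : fine (P (s + t) 0 A) = \int[P s 0]_(y in D) fine (P t y A).
  case: cbi => [[_ PP] _]; rewrite PP // /Rintegral; congr fine.
  by apply: eq_integral => y _; rewrite fineK // P_fin.
rewrite -{1}(Rcst (fine (P t x A))) -RintegralB //.
have di := integrableB _ (cst_int (fine (P t x A))) PAi.
apply: (le_trans (le_normr_Rintegral _ (di _))) => //.
(* The Lipschitz factor |x - y| is bounded by x + y, whose mean under P_s(0, .) is at most x + C. *)
apply: (@le_trans _ _ (\int[P s 0]_(y in D) (V * (x + y)))).
  apply: le_Rintegral => //.
  - by apply: integrable_norm; exact: di.
  - by have := integrableZl _ V (integrableD _ (cst_int x) yi); apply.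
  - move=> y; rewrite /= in_itv /= andbT => y0.
    apply: (le_trans (CBI_set_lipschitz t0 x0 y0 vV mA)).
    rewrite mulrC ler_wpM2l // (le_trans (ler_normB _ _)) // !ger0_norm //.
rewrite RintegralZl //; last by have := integrableD _ (cst_int x) yi; apply.
by rewrite RintegralD // Rcst mulrC ler_wpM2r // lerD2l.
Qed.

Context (theta : R) (theta_gt0 : 0 < theta).
Context (grey : (\int[leb]_(z in `[theta, +oo[) ((phi z)^-1)%:E < +oo)%E).

Lemma CBI_setwise_limit : exists eta : probability RM R,
  (exists2 eps : nat -> R, eps n @[n --> \oo] --> 0 & forall n A, measurable A ->
     `|fine (P n.+1%:R 0 A) - fine (eta A)| <= eps n) /\
  forall x t V A, 0 <= x -> 0 <= t -> (forall lam, 0 <= lam -> v t lam <= V) ->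
    measurable A -> `|fine (P t x A) - fine (eta A)| <= (x + C) * V.
Proof.
have [V1 _ vV1] := cumulant_limit_fin b_gt0 c_ge0 bm cv theta_gt0 ltr01 grey.
(* The Cauchy bound from state 0 at time n + 1, with the decay counted from time 1, where the flow
   is bounded uniformly in lambda by [V1]. *)
pose eps (n : nat) := C * (V1 * expR (b * (1 - n.+1%:R))).
have eps0 : eps n @[n --> \oo] --> 0.
  rewrite -(mulr0 C) /eps; apply: cvgMr; rewrite -(mulr0 V1); apply: cvgMr.
  have -> : (fun n : nat => expR (b * (1 - n.+1%:R))) = (fun n : nat => expR (- b) ^+ n).
    by apply/funext => n; rewrite -expRM_natl -natr1; congr expR; ring.
  by apply: cvg_expr; rewrite ger0_norm ?expR_ge0 // expR_lt1 oppr_lt0.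
have pc n k A : measurable A -> (n <= k)%N ->
    `|fine (P n.+1%:R 0 A) - fine (P k.+1%:R 0 A)| <= eps n.
  move=> mA nk.
  have -> : k.+1%:R = (k - n)%:R + n.+1%:R :> R by rewrite -natrD addnS subnK.
  rewrite /eps -[X in X * _]add0r; apply: CBI_set_cauchy => //.
  by apply: (cumulant_bound_decay b_gt0 c_ge0 bm cv) => //; rewrite ler1n.
have [eta etaP] := setwise_limit_probability (p := fun n => P n.+1%:R 0)
  (fun n => prob_kernel (s := P n.+1%:R) 0) eps0 pc.
exists eta; split; first by exists eps.
move=> x t V A x0 t0 vV mA.
have lim : (x + C) * V + eps n @[n --> \oo] --> (x + C) * V.
  by rewrite -[X in _ --> X]addr0; apply: cvgD => //; exact: cvg_cst.
apply: (cvgr_to_ge lim); near=> n.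
have tn : t <= n.+1%:R.
  rewrite (@le_trans _ _ n%:R) ?ler_nat //; near: n; exact: nbhs_infty_ger.
have nt0 : 0 <= n.+1%:R - t by rewrite subr_ge0.
have h1 := CBI_set_cauchy nt0 t0 x0 vV mA; rewrite subrK in h1.
apply: (le_trans _ (lerD h1 (etaP n A mA))).
by apply: (le_trans _ (ler_normD _ _)); rewrite addrA subrK.
Unshelve. all: by end_near. Qed.

(** Uniform closeness on sets bounds the integrals of e^{-lam y} with the same [eps]. On the other
    side, the exponents increase to an integral bounded by C lam, so the limit passes through the
    exponential. *)
Lemma CBI_limit_laplace (eta : probability RM R) (eps : nat -> R) lam : 0 <= lam ->
  eps n @[n --> \oo] --> 0 -> (forall n A, measurable A ->
     `|fine (P n.+1%:R 0 A) - fine (eta A)| <= eps n) ->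
  laplace eta lam = expeR (- (\int[leb]_(s in `[0%R, +oo[) (psi (v s lam))%:E))%E.
Proof.
move=> l0 eps0 etaP.
pose e y := expR (- (lam * y)).
have eE y : expsum [:: (1, lam)] y = e y by rewrite /expsum big_seq1 mul1r.
have me : measurable_fun (D : set RM) e.
  by apply: eq_measurable_fun (@expsum_measurable R [:: (1, lam)] D) => y _; rewrite eE.
have e1 y : 0 <= y -> 0 <= e y <= 1 by move=> y0; apply: expRN_itv; exact: mulr_ge0.
have etaD : (eta D <= 1)%E by exact: probability_le1.
have PD1 n : (P n.+1%:R 0%R D <= 1)%E by rewrite [X in (X <= _)%E]P_D.
have dist n : `|\int[P n.+1%:R 0]_(y in D) e y - \int[eta]_(y in D) e y| <= eps n.
  by apply: measure_dist_sets => // A mA _; exact: etaP.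
have intE n : \int[P n.+1%:R 0]_(y in D) e y = expR (- J n.+1%:R lam).
  by have := P_laplace0 (ler0n R n.+1) l0; rewrite /laplace /Rintegral => ->.
have cvg_e : expR (- J n.+1%:R lam) @[n --> \oo] --> \int[eta]_(y in D) e y.
  apply/cvgrPdist_le => d d0; near=> n; rewrite -intE distrC (le_trans (dist n)) //.
  apply: (le_trans (ler_norm _)); rewrite -normrN -sub0r; near: n.
  by move: d d0; apply/cvgrPdist_le.
have JE n : (\int[leb]_(s in `[0%R, n.+1%:R]) (psi (v s lam))%:E)%E = (J n.+1%:R lam)%:E.
  rewrite /J /Rintegral fineK //; apply: integrable_fin_num => //.
  exact: psi_path_integrable.
have psi0 z : 0 <= z -> 0 <= psi z by move=> /immigration_mechanism_le /andP[].
have := cumulant_time_integral_cvg b_gt0 phi0 phi_lb cv psi_cont psi0 l0.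
set I := (\int[leb]_(s in `[0%R, +oo[) _)%E => cI.
have cJ : (J n.+1%:R lam)%:E @[n --> \oo] --> I.
  under eq_cvg do rewrite -JE.
  by have := cI; rewrite -(cvg_shiftS (fun n => (\int[leb]_(s in `[0%R, n%:R]) _)%E)).
have I0 : (0 <= I)%E.
  apply: integral_ge0 => s; rewrite /= in_itv /= andbT => s0.
  by rewrite lee_fin psi0 // (cumulant_ge0 cv).
have IC : (I <= (C * lam)%:E)%E.
  apply: (cvge_to_le cJ); near=> n.
  by rewrite lee_fin; have /andP[] := J_itv l0 (ler0n R n.+1).
have Ifin : I \is a fin_num by rewrite ge0_fin_numE //; exact: le_lt_trans IC (ltry _).
move: cJ; rewrite -(fineK Ifin) => /fine_cvgP[_] cJ.
have lapE : laplace eta lam = (\int[eta]_(y in D) e y)%:E.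
  rewrite /laplace /Rintegral fineK //; apply: integrable_fin_num => //.
  apply: unit_integrable => //; exact: le_lt_trans etaD (ltry _).
rewrite lapE /=; congr EFin.
apply: (cvg_unique _ cvg_e) => //; apply: continuous_cvg; first exact: continuous_expR.
exact: cvgN.
Unshelve. all: by end_near. Qed.

Lemma CBI_time_change lam : 0 <= lam ->
  (\int[leb]_(s in `[0%R, +oo[) (psi (v s lam))%:E =
   \int[leb]_(z in `[0%R, lam]) (psi z / phi z)%:E)%E.
Proof.
(* For lam = 0 the flow is constantly 0 and the substitution degenerates; both integrals vanish. *)
rewrite le_eqVlt => /predU1P[<-|l0].
  rewrite set_itv1 integral_set1; apply: integral0_eq => s.
  rewrite /= in_itv /= andbT => s0.
  have -> : v s 0 = 0.
    apply/le_anti; rewrite (cumulant_ge0 cv) // andbT.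
    exact: (cumulant_le_init b_gt0 phi0 phi_lb cv).
  by rewrite immigration_mechanism0.
apply: (cumulant_time_change_pinfty b_gt0 phi0 phi_lb phi_ub cv psi_cont) => //.
by move=> z /immigration_mechanism_le /andP[].
Qed.

End ergodicity.

(** Writing f = 2 g - 1 with g in [0, 1], the constant cancels as the masses agree, and only the
    factor 2 remains. *)
Lemma var_norm_sub_le (R : realType) (mu1 mu2 : {measure set (measurableTypeR R) -> \bar R})
    (K : R) : let D := `[0%R, +oo[%classic : set R in
  (mu1 D <= 1)%E -> (mu2 D <= 1)%E ->
  (forall A : set (measurableTypeR R), measurable A -> A `<=` D ->
    `|fine (mu1 A) - fine (mu2 A)| <= K) ->
  mu1 D = mu2 D -> (var_norm_sub mu1 mu2 <= (2 * K)%:E)%E.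
Proof.
move=> D le1 le2 muK mu12; apply: ge_ereal_sup => _ [f [mf f1] <-].
have mD : measurable (D : set (measurableTypeR R)) by exact: measurable_itv.
have fin1 : (mu1 D < +oo)%E by apply: le_lt_trans le1 (ltry _).
have fin2 : (mu2 D < +oo)%E by apply: le_lt_trans le2 (ltry _).
pose g y := (f y + 1) / 2.
have mg : measurable_fun (D : set (measurableTypeR R)) g.
  by apply: measurable_funM => //; exact: measurable_funD.
have g1 (y : R) : 0 <= y -> 0 <= g y <= 1.
  by move=> /f1; rewrite ler_norml /g => /andP[? ?]; apply/andP; split; lra.
have fE (mu : {measure set (measurableTypeR R) -> \bar R}) : (mu D < +oo)%E ->
    (\int[mu]_(y in D) (f y)%:E)%E =
      (2 * \int[mu]_(y in D) g y - fine (mu D))%:E.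
  move=> muD.
  have fi : mu.-integrable D (EFin \o f).
    apply: (@integrable_norm_le _ _ _ _ _ _ 1) => // y.
    by rewrite /D /= in_itv /= andbT; exact: f1.
  have gi := unit_integrable muD mg g1.
  have ci : mu.-integrable D (EFin \o (fun=> 1 : R)).
    by apply: (@integrable_norm_le _ _ _ _ _ _ 1) => // y _; rewrite normr1.
  rewrite -(fineK (integrable_fin_num _ fi)) //; congr EFin.
  rewrite -[LHS]/(\int[mu]_(y in D) f y) -[fine (mu D)]mul1r -Rintegral_cst //.
  rewrite -RintegralZl // -RintegralB //; last by have := integrableZl mD 2 gi; apply.
  by apply: eq_Rintegral => y _; rewrite /g; field.
rewrite !fE // -EFinB abse_EFin lee_fin mu12.
rewrite (_ : _ - (_ - _) = 2 * (\int[mu1]_(y in D) g y - \int[mu2]_(y in D) g y)); last by ring.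
by rewrite normrM ger0_norm // ler_wpM2l // measure_dist_sets.
Qed.

Theorem theorem10p5 (R : realType) (b c beta : R)
    (m nu : {measure set (measurableTypeR R) -> \bar R})
    (v : R -> R -> R)
    (P : R -> R.-pker (measurableTypeR R) ~> (measurableTypeR R))
    (theta : R) :
  let phi := branching_mechanism b c m in
  let psi := immigration_mechanism beta nu in
  0 <= c -> branching_measure m ->
  0 <= beta -> immigration_measure nu ->
  (\int[nu]_(u in `]0%R, +oo[) u%:E < +oo)%E ->
  cumulant_semigroup phi v ->
  CBI_semigroup psi v P ->
  0 < b ->
  0 < theta ->
  (forall z : R, theta <= z -> 0 < phi z) ->
  (\int[lebesgue_measure]_(z in `[theta, +oo[) ((phi z)^-1)%:E < +oo)%E ->
  exists eta : probability (measurableTypeR R) R,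
    [/\ eta (`[0%R, +oo[%classic : set R) = 1%E,
        forall lambda : R, 0 <= lambda ->
          laplace eta lambda =
            expeR (- (\int[lebesgue_measure]_(s in `[0%R, +oo[)
                        (psi (v s lambda))%:E))%E /\
          laplace eta lambda =
            expeR (- (\int[lebesgue_measure]_(z in `[0%R, lambda])
                        (psi z / phi z)%:E))%E
      & forall x t r : R, 0 <= x -> 0 < r -> r <= t ->
          (var_norm_sub (P t x) eta <=
           (2 * (x + b^-1 * immigration_mean beta nu))%:E
           * cumulant_limit v r * (expR (b * (r - t)))%:E)%E].
Proof.
move=> phi psi c0 bm beta0 _ num cv cbi b0 th0 _ grey.
have [eta [[eps eps0 etaP] etaV]] :=
  CBI_setwise_limit b0 c0 bm beta0 num cv cbi th0 grey.
have PD t x : 0 <= t -> 0 <= x -> P t x (`[0%R, +oo[%classic : set R) = 1%E.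
  by move=> t0 x0; case: cbi => [[+ _] _]; exact.
have etaD : eta (`[0%R, +oo[%classic : set R) = 1%E.
  have Dfin : eta (`[0%R, +oo[%classic : set R) \is a fin_num by exact: fin_num_measure.
  rewrite -(fineK Dfin); congr EFin; apply/eqP; rewrite eq_sym -subr_eq0 -normr_le0.
  (* Each P_{n+1}(0, .) gives the half-line mass 1, so the defect of eta is at most [eps n] for
     every n. *)
  apply: (cvgr_to_ge eps0); near=> n.
  have := etaP n (`[0%R, +oo[%classic : set R) (measurable_itv _).
  by rewrite PD.
exists eta; split => //.
- move=> lam l0; rewrite -(CBI_time_change b0 c0 bm beta0 num cv) //.
  by split; apply: (CBI_limit_laplace b0 c0 bm beta0 num cv cbi l0 eps0 etaP).
- move=> x t r x0 r0 rt; have t0 := le_trans (ltW r0) rt.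
  have [V -> vV] := cumulant_limit_fin b0 c0 bm cv th0 r0 grey.
  rewrite -!EFinM -!mulrA; apply: var_norm_sub_le; rewrite ?PD ?etaD //.
    exact: probability_le1.
  move=> A mA _; apply: etaV => //.
  exact: (cumulant_bound_decay b0 c0 bm cv (ltW r0) rt vV).
Unshelve. all: by end_near. Qed.
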